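(* Let $n\ge 1$ and let $I_n=\mathrm{diag}(0,1,\dots,1)\in\mathrm{Sym}(\mathbb R^{n+1})$. For every $A\in\mathrm{Sym}(\mathbb R^{n+1})\setminus\mathcal S$, every eigenvalue of $I_n+\sqrt{-1}A$ is nonzero and has nonnegative real part, so $\widehat\Theta(A)$ is defined; moreover the function $\widehat\Theta:\mathrm{Sym}(\mathbb R^{n+1})\setminus\mathcal S\to\mathbb R$ is differentiable. Furthermore, $\widetilde\Theta$ is the smallest upper semicontinuous function on $\mathrm{Sym}(\mathbb R^{n+1})$ that extends $\widehat\Theta$, and $\underline{\widetilde\Theta}$ is the largest lower semicontinuous function on $\mathrm{Sym}(\mathbb R^{n+1})$ that extends $\widehat\Theta$.
   Context: For $A=[a_{ij}]_{i,j=0}^n\in\mathrm{Sym}(\mathbb R^{n+1})$ write $A^+=[a_{ij}]_{i,j=1}^n\in\mathrm{Sym}(\mathbb R^n)$ and $\vec a_0=(a_{01},\dots,a_{0n})$. Let $\mathcal S=\{A\in\mathrm{Sym}(\mathbb R^{n+1}): A=\mathrm{diag}(0,A^+)\}$ (first row and column vanish). $\arg$ denotes the branch of the argument with values in $(-\pi,\pi]$, and $\tan^{-1}$ has values in $(-\pi/2,\pi/2)$; for a real symmetric matrix $M$, $\tan^{-1}M$ is defined by applying $\tan^{-1}$ to the eigenvalues. For $A\notin\mathcal S$ set $\widehat\Theta(A)=\sum_{\lambda\in\mathrm{spec}(I_n+\sqrt{-1}A)} m(\lambda)\arg(\lambda)$, where $m(\lambda)$ is the multiplicity of $\lambda$ as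 a root of the characteristic polynomial. Define $\widetilde\Theta,\underline{\widetilde\Theta}:\mathrm{Sym}(\mathbb R^{n+1})\to\mathbb R$ by $\widetilde\Theta=\underline{\widetilde\Theta}=\widehat\Theta$ off $\mathcal S$, and for $A\in\mathcal S$: $\widetilde\Theta(A)=\pi/2+\mathrm{tr}\tan^{-1}(A^+)$, $\underline{\widetilde\Theta}(A)=-\pi/2+\mathrm{tr}\tan^{-1}(A^+)$. *)

(* Defs.v *)
From Stdlib Require Import Reals List Arith ClassicalEpsilon ClassicalDescription.
Open Scope R_scope.

Definition C : Type := (R * R)%type.
Definition C0 : C := (0, 0).
Definition C1 : C := (1, 0).
Definition Cadd (z w : C) : C := (fst z + fst w, snd z + snd w).
Definition Copp (z : C) : C := (- fst z, - snd z).
Definition Csub (z w : C) : C := Cadd z (Copp w).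
Definition Cmul (z w : C) : C :=
  (fst z * fst w - snd z * snd w, fst z * snd w + snd z * fst w).
Definition RtoC (x : R) : C := (x, 0).

(** Principal argument, values in (-PI, PI] (arg 0 := 0, never used). *)
Definition Carg (z : C) : R :=
  let x := fst z in let y := snd z in
  if Rlt_dec 0 x then atan (y / x)
  else if Rlt_dec x 0 then
    (if Rle_dec 0 y then atan (y / x) + PI else atan (y / x) - PI)
  else if Rlt_dec 0 y then PI / 2
  else if Rlt_dec y 0 then - (PI / 2) else 0.

(** * Square matrices: entries indexed by nat; a k x k matrix uses 0..k-1. *)
Definition Mat := nat -> nat -> R.
Definition CMat := nat -> nat -> C.

Fixpoint Csum (k : nat) (f : nat -> C) : C :=
  match k with O => C0 | S k' => Cadd (Csum k' f) (f k') end.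

Definition Cprod (l : list C) : C := fold_right Cmul C1 l.

Definition minor (j : nat) (M : CMat) : CMat :=
  fun r c => M (S r) (if Nat.ltb c j then c else S c).

Fixpoint det (k : nat) (M : CMat) : C :=
  match k with
  | O => C1
  | S k' => Csum k (fun j =>
      Cmul (if Nat.even j then C1 else Copp C1) (Cmul (M 0%nat j) (det k' (minor j M))))
  end.

Definition charpoly (k : nat) (M : CMat) (z : C) : C :=
  det k (fun i j => if Nat.eqb i j then Csub z (M i j) else Copp (M i j)).

Definition is_spectrum (k : nat) (M : CMat) (l : list C) : Prop :=
  length l = k /\ forall z, charpoly k M z = Cprod (map (fun lam => Csub z lam) l).

Definition spectrum (k : nat) (M : CMat) : list C :=
  epsilon (inhabits nil) (is_spectrum k M).

Definition realM (B : Mat) : CMat := fun i j => RtoC (B i j).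
Definition is_real_spectrum (k : nat) (B : Mat) (l : list R) : Prop :=
  length l = k /\
  forall x : R, charpoly k (realM B) (RtoC x) = Cprod (map (fun mu => RtoC (x - mu)) l).
Definition real_spectrum (k : nat) (B : Mat) : list R :=
  epsilon (inhabits nil) (is_real_spectrum k B).

Definition Rlsum (l : list R) : R := fold_right Rplus 0 l.

Definition Sym (n : nat) (A : Mat) : Prop :=
  forall i j, (i <= n)%nat -> (j <= n)%nat -> A i j = A j i.

Definition in_S (n : nat) (A : Mat) : Prop :=
  forall j, (j <= n)%nat -> A 0%nat j = 0 /\ A j 0%nat = 0.

Definition In_mat : Mat :=
  fun i j => if (Nat.eqb i j && Nat.ltb 0 i)%bool then 1 else 0.

Definition IiA (A : Mat) : CMat := fun i j => (In_mat i j, A i j).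

Definition is_eigenvalue (n : nat) (A : Mat) (z : C) : Prop :=
  charpoly (S n) (IiA A) z = C0.

Definition Theta_hat (n : nat) (A : Mat) : R :=
  Rlsum (map Carg (spectrum (S n) (IiA A))).

Definition Aplus (A : Mat) : Mat := fun i j => A (S i) (S j).
Definition tr_atan (n : nat) (A : Mat) : R :=
  Rlsum (map atan (real_spectrum n (Aplus A))).

Definition Theta_tilde (n : nat) (A : Mat) : R :=
  if excluded_middle_informative (in_S n A) then PI / 2 + tr_atan n A
  else Theta_hat n A.

Definition Theta_tilde_low (n : nat) (A : Mat) : R :=
  if excluded_middle_informative (in_S n A) then - (PI / 2) + tr_atan n A
  else Theta_hat n A.

Definition mdist (n : nat) (A B : Mat) : R :=
  sqrt (sum_f_R0 (fun i => sum_f_R0 (fun j => (A i j - B i j) ^ 2) n) n).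

Definition mzero : Mat := fun _ _ => 0.
Definition madd (A B : Mat) : Mat := fun i j => A i j + B i j.
Definition mscal (c : R) (A : Mat) : Mat := fun i j => c * A i j.

Definition usc_on_Sym (n : nat) (f : Mat -> R) : Prop :=
  forall A, Sym n A -> forall eps, 0 < eps -> exists delta, 0 < delta /\
    forall B, Sym n B -> mdist n A B < delta -> f B < f A + eps.

Definition lsc_on_Sym (n : nat) (f : Mat -> R) : Prop :=
  forall A, Sym n A -> forall eps, 0 < eps -> exists delta, 0 < delta /\
    forall B, Sym n B -> mdist n A B < delta -> f A - eps < f B.

Definition differentiable_at_Sym (n : nat) (f : Mat -> R) (A : Mat) : Prop :=
  exists L : Mat -> R,
    (forall H1 H2, Sym n H1 -> Sym n H2 -> L (madd H1 H2) = L H1 + L H2) /\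
    (forall c H, Sym n H -> L (mscal c H) = c * L H) /\
    (forall eps, 0 < eps -> exists delta, 0 < delta /\
       forall H, Sym n H -> mdist n H mzero < delta ->
         Rabs (f (madd A H) - f A - L H) <= eps * mdist n H mzero).

(* Main.v *)
(** Write [M(A) = I_n + iA].  Pairing an eigenvector with its conjugate shows that the
    eigenvalues of [M(A)] lie in the closed right half-plane, and that 0 occurs only for
    [A] in [S], where the spectrum is [0 :: 1 + i mu_j] with [mu_j] the eigenvalues of [A^+].
    Hence both extensions are sums over the spectrum of the argument, extended at 0 by
    [PI/2], resp. [-PI/2]: an upper, resp. lower, semicontinuous function of the right
    half-plane.  Spectra depend continuously on [A] as multisets, by compactness and
    unique factorisation, so the sums inherit semicontinuity.  Extremality is tested on
    [A + t e_00] with [t] tending to 0.  Off [S] the sum is continuous and is a branch of the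
    argument of [det M(A)], and a continuous branch of the argument of a nonvanishing
    polynomial is differentiable. *)

From Stdlib Require Import Reals List Lra Lia ClassicalEpsilon ClassicalDescription.
From mathcomp Require all_boot all_order all_algebra complex Rstruct ring.
Require Import Defs.
Open Scope R_scope.

(** * Spectra *)

(* The MathComp notations are confined to this module: they would change the meaning
   of [<=] on [nat] in the main theorem. *)
Module Spectra.
Import all_boot all_order all_algebra complex Rstruct.
Import ring.
Import Order.TTheory GRing.Theory Num.Theory.
Local Open Scope ring_scope.
Local Open Scope complex_scope.

(** * Transfer of determinants and characteristic polynomials to [R[i]] *)

Definition toC (z : C) : R[i] := fst z +i* snd z.

Definition ofC (x : R[i]) : C := (complex.Re x, complex.Im x).

Lemma toCK : cancel toC ofC.
Proof. by case. Qed.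

Lemma ofCK : cancel ofC toC.
Proof. by case. Qed.

Lemma toC_inj : injective toC.
Proof. exact: can_inj toCK. Qed.

Lemma toCD z w : toC (Cadd z w) = toC z + toC w.
Proof. by []. Qed.

Lemma toCN z : toC (Copp z) = - toC z.
Proof. by []. Qed.

Lemma toCB z w : toC (Csub z w) = toC z - toC w.
Proof. by []. Qed.

Lemma toCM z w : toC (Cmul z w) = toC z * toC w.
Proof. by []. Qed.

Lemma toC1 : toC C1 = 1.
Proof. by []. Qed.

Lemma toC0 : toC C0 = 0.
Proof. by []. Qed.

Lemma toC_Csum k f : toC (Csum k f) = \sum_(i < k) toC (f i).
Proof.
elim: k => [|k IHk] /=; first by rewrite big_ord0.
by rewrite big_ord_recr /= toCD IHk.
Qed.

Lemma toC_Cprod l : toC (Cprod l) = \prod_(x <- map toC l) x.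
Proof.
elim: l => [|a l IHl] /=; first by rewrite big_nil.
by rewrite big_cons toCM IHl.
Qed.

Definition toMx k (M : CMat) : 'M[R[i]]_k := \matrix_(i < k, j < k) toC (M i j).

Lemma toC_sign j : toC (if Nat.even j then C1 else Copp C1) = (-1) ^+ j.
Proof.
have -> : Nat.even j = ~~ odd j.
  by elim: j => // j IHj; rewrite PeanoNat.Nat.even_succ -PeanoNat.Nat.negb_even IHj.
by rewrite -signr_odd; case: (odd j) => /=; rewrite ?toCN toC1 ?expr1 ?expr0.
Qed.

(** Both sides are Laplace expansions along row 0, and [minor] skips column [j] by the same index
    shift as [lift]. *)
Lemma toC_det k M : toC (det k M) = \det (toMx k M).
Proof.
elim: k M => [|k IHk] M; first by rewrite det_mx00.
rewrite (expand_det_row _ ord0) [det _ _]/= -[Cadd _ _]/(Csum k.+1 _) toC_Csum.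
apply: eq_bigr => j _; rewrite !toCM toC_sign IHk mxE /cofactor add0n mulrCA.
congr (_ * (_ * \det _)); apply/matrixP => r c; rewrite !mxE /minor.
congr (toC (M _ _)); rewrite /= /bump.
case: PeanoNat.Nat.ltb_spec0 => /ssrnat.ltP; last by rewrite -leqNgt => ->.
by rewrite ltnNge => /negbTE ->.
Qed.

Lemma horner_char_poly k (M : 'M[R[i]]_k) x : (char_poly M).[x] = \det (x%:M - M).
Proof.
rewrite /char_poly -[LHS]/(horner_eval x _) -det_map_mx.
congr (\det _); apply/matrixP => i j; rewrite !mxE /= /horner_eval.
by rewrite hornerD hornerN hornerC hornerMn hornerX.
Qed.

Lemma toC_charpoly k M z :
  toC (charpoly k M z) = (char_poly (toMx k M)).[toC z].
Proof.
rewrite /charpoly toC_det horner_char_poly.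
congr (\det _); apply/matrixP => i j; rewrite !mxE -val_eqE.
have -> : Nat.eqb i j = (val i == val j) by apply/idP/eqP => /PeanoNat.Nat.eqb_eq.
by case: eqP; rewrite ?toCB ?toCN ?mulr1n // mulr0n add0r.
Qed.

Lemma prod_XsubC_horner (l : seq R[i]) (x : R[i]) :
  (\prod_(y <- l) ('X - y%:P)).[x] = \prod_(y <- l) (x - y).
Proof. by rewrite horner_prod; apply: eq_bigr => y _; rewrite hornerXsubC. Qed.

Lemma toC_prod_sub z l :
  toC (Cprod (List.map (fun lam => Csub z lam) l)) =
  (\prod_(y <- map toC l) ('X - y%:P)).[toC z].
Proof.
rewrite prod_XsubC_horner toC_Cprod !big_map.
by apply: eq_bigr => y _; rewrite toCB.
Qed.

(** The difference vanishes at 0, 1, 2, ..., which gives more roots than its degree allows. This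
    lets factorisations tested at real points only determine the polynomial. *)
Lemma poly_eq_on_reals (p q : {poly R[i]}) :
  (forall x : R, p.[x%:C] = q.[x%:C]) -> p = q.
Proof.
move=> pq; apply/eqP; rewrite -subr_eq0; apply/eqP.
pose rs := [seq (n%:R : R[i]) | n <- iota 0 (size (p - q))].
apply: (@roots_geq_poly_eq0 _ _ rs).
- apply/allP => x /mapP [n _ ->]; rewrite /root hornerD hornerN.
  have -> : (n%:R : R[i]) = (n%:R)%:C by rewrite rmorph_nat.
  by rewrite pq subrr.
- rewrite map_inj_uniq ?iota_uniq //.
  by move=> m n /eqP; rewrite eqr_nat => /eqP.
- by rewrite size_map size_iota.
Qed.

(** A pointwise identity becomes an equality of polynomials, to which unique factorisation applies;
    conversely the length of [l] is forced by the degree. *)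
Lemma is_spectrumP k M l :
  is_spectrum k M l <->
  char_poly (toMx k M) = \prod_(y <- map toC l) ('X - y%:P).
Proof.
split=> [[_ eqM]|eqM].
  apply: poly_eq_on_reals => x.
  by rewrite -[x%:C]/(toC (RtoC x)) -toC_charpoly eqM toC_prod_sub.
split=> [|z]; last by apply: toC_inj; rewrite toC_charpoly eqM toC_prod_sub.
have := size_char_poly (toMx k M).
rewrite eqM size_prod_XsubC size_map => -[<-].
by elim: l {eqM} => //= a l ->.
Qed.

(** Since [R[i]] is algebraically closed, a factorisation exists and the choice by [epsilon] is a
    genuine one. *)
Lemma spectrumP k M : is_spectrum k M (spectrum k M).
Proof.
rewrite /spectrum; apply: epsilon_spec.
have [r] := closed_field_poly_normal (char_poly (toMx k M)).
rewrite (monicP (char_poly_monic _)) scale1r => eqr.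
exists (map ofC r); apply/is_spectrumP.
by rewrite eqr -map_comp (eq_map ofCK) map_id.
Qed.

Lemma RlsumE (T : Type) (g : T -> R) (l : seq T) :
  Rlsum (List.map g l) = \sum_(x <- l) g x.
Proof.
elim: l => [|a l IHl]; first by rewrite big_nil.
by rewrite big_cons -IHl.
Qed.

(** Unique factorisation makes the two lists permutations of each other, so spectral sums do not
    depend on the list chosen by [epsilon]. *)
Lemma spectrum_sum_unique k M l l' (g : C -> R) :
  is_spectrum k M l -> is_spectrum k M l' ->
  Rlsum (List.map g l) = Rlsum (List.map g l').
Proof.
move=> /is_spectrumP Ml /is_spectrumP; rewrite Ml => /prod_XsubC_eq.
move=> /(perm_map ofC).
by rewrite !(mapK toCK) !RlsumE => ll'; apply: perm_big.
Qed.

(** * Eigenvectors and the location of the eigenvalues *)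

Lemma charpoly_eigenvector k M z :
  charpoly k M z = C0 ->
  exists2 v : 'rV[R[i]]_k, v != 0 & v *m toMx k M = toC z *: v.
Proof.
move=> /(congr1 toC); rewrite toC_charpoly => zM.
have /eigenvalueP [v vM v0] : eigenvalue (toMx k M) (toC z).
  by rewrite eigenvalue_root_char /root zM.
by exists v.
Qed.

Lemma in_spectrum_charpoly k M l z :
  is_spectrum k M l -> List.In z l -> charpoly k M z = C0.
Proof.
move=> [_ ->]; elim: l => //= a l IHl; set P := Cprod _.
move=> [->|/IHl P0]; apply: toC_inj; rewrite toCM toCB.
  by rewrite subrr mul0r.
by rewrite /P P0 mulr0.
Qed.

(** The squared modulus as an element of [R], whereas the norm of [R[i]] takes values in [R[i]]. *)
Definition sqnorm (x : R[i]) := complex.Re x ^+ 2 + complex.Im x ^+ 2.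

Lemma sqnorm_ge0 x : 0 <= sqnorm x.
Proof. by rewrite addr_ge0 ?sqr_ge0. Qed.

Lemma sqnorm_eq0 x : sqnorm x = 0 -> x = 0.
Proof.
move=> /eqP; rewrite paddr_eq0 ?sqr_ge0 // !sqrf_eq0 => /andP [/eqP a0 /eqP b0].
by case: x a0 b0 => a b /= -> ->.
Qed.

Lemma mulcJ (x : R[i]) : x * conjc x = (sqnorm x)%:C.
Proof. by rewrite /sqnorm; case: x => a b; congr (_ +i* _) => /=; ring. Qed.

(* Pairing an eigenvector v with its conjugate, the imaginary part of M contributes
   i * (v A v^* ) with v A v^* real, hence nothing to the real part. *)
Lemma eigenvalue_real_part k (M : CMat) (z : C) (v : 'rV[R[i]]_k) :
  (forall i j : 'I_k, i != j -> fst (M i j) = 0) ->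
  (forall i j : 'I_k, snd (M i j) = snd (M j i)) ->
  v *m toMx k M = toC z *: v ->
  let n j := sqnorm (v 0 j) in
  fst z * (\sum_j n j) = \sum_(j < k) fst (M j j) * n j.
Proof.
move=> Mdiag Msym vM n.
pose q := \sum_(j < k) \sum_(i < k) v 0 i * (snd (M i j))%:C * conjc (v 0 j).
have q_real : conjc q = q.
  rewrite /q rmorph_sum exchange_big; apply: eq_bigr => i _ /=.
  rewrite rmorph_sum; apply: eq_bigr => j _.
  by rewrite Msym; case: (v 0 i) (v 0 j) => a b [c d]; congr (_ +i* _) => /=; ring.
have Req : complex.Re ('i * q) = 0.
  by rewrite mulrC ReiNIm -[q]RRe_real ?oppr0 //; apply/CrealP; exact: q_real.
have : toC z * (\sum_j n j)%:C = (\sum_(j < k) fst (M j j) * n j)%:C + 'i * q.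
  rewrite !rmorph_sum !mulr_sumr -big_split /=; apply: eq_bigr => j _.
  rewrite -mulcJ mulrA.
  move/matrixP: vM => /(_ 0 j); rewrite !mxE => <-.
  rewrite mulr_suml mulr_sumr (bigD1 j) //= [in RHS](bigD1 j) //= addrA.
  congr (_ + _).
    by rewrite mxE /n /sqnorm; case: (v 0 j) (M j j) => a b [c d]; congr (_ +i* _) => /=; ring.
  apply: eq_bigr => i ij; rewrite mxE; move: (Mdiag i j ij).
  by case: (v 0 j) (v 0 i) (M i j) => a b [c d] [e f] /= ->; congr (_ +i* _) => /=; ring.
have ReD (x y : R[i]) : complex.Re (x + y) = complex.Re x + complex.Re y.
  by case: x y => [? ?] [].
move=> /(congr1 (@complex.Re R)); by rewrite ReD Req addr0 /= mulr0 subr0.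
Qed.

Lemma sum_sqnorm_gt0 k (v : 'rV[R[i]]_k) : v != 0 -> 0 < \sum_j sqnorm (v 0 j).
Proof.
move=> v0; rewrite lt_neqAle sumr_ge0 ?andbT => [|j _]; last exact: sqnorm_ge0.
apply: contra v0 => /eqP /esym /psumr_eq0P v0.
apply/eqP/rowP => j; rewrite mxE; apply: sqnorm_eq0.
by apply: v0 => // i _; apply: sqnorm_ge0.
Qed.

(** The real part of the matrix is diag(0, 1, ..., 1), so the pairing loses exactly the coordinate 0
    of [v]. Both the sign of the real part and the exclusion of 0 are read off from this
    identity. *)
Lemma IiA_eigenvector n A z : Sym n A -> is_eigenvalue n A z ->
  exists v : 'rV[R[i]]_n.+1, [/\ v != 0, v *m toMx n.+1 (IiA A) = toC z *: v &
    fst z * (\sum_j sqnorm (v 0 j)) = \sum_(j < n) sqnorm (v 0 (lift ord0 j))].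
Proof.
move=> symA /charpoly_eigenvector [v v0 vM]; exists v; split=> //.
rewrite (eigenvalue_real_part _ _ _ _ _ _ vM) => [|i j ij|i j] /=.
- rewrite big_ord_recl /= mul0r add0r; apply: eq_bigr => j _.
  by rewrite /In_mat /= PeanoNat.Nat.eqb_refl mul1r.
- rewrite /In_mat; case: PeanoNat.Nat.eqb_spec => //= /val_inj ji.
  by rewrite ji eqxx in ij.
- by apply: symA; apply/ssrnat.leP; rewrite -ltnS ltn_ord.
Qed.

Lemma eigenvalue_re_ge0 n A z : Sym n A -> is_eigenvalue n A z -> Rle 0 (fst z).
Proof.
move=> symA /(IiA_eigenvector _ _ _ symA) [v [/sum_sqnorm_gt0 v0 _ eqz]].
apply/RleP; rewrite -(pmulr_lge0 _ v0) eqz.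
by apply: sumr_ge0 => j _; apply: sqnorm_ge0.
Qed.

(** For the eigenvalue 0 all coordinates of [v] except the first vanish, so [v] is a multiple of
    e_0, and v M = 0 then says that row 0 of [A] is zero. *)
Lemma eigenvalue_neq0 n A : Sym n A -> ~ in_S n A -> ~ is_eigenvalue n A C0.
Proof.
move=> symA nS /(IiA_eigenvector _ _ _ symA) [v [v0 vM]].
rewrite mul0r => /esym /psumr_eq0P vj.
have {}vj (j : 'I_n) : v 0 (lift ord0 j) = 0.
  by apply/sqnorm_eq0/vj => // i _; apply: sqnorm_ge0.
have v00 : v 0 ord0 != 0.
  apply: contra v0 => /eqP v00; apply/eqP/rowP => j; rewrite mxE.
  by case: (unliftP ord0 j) => [i|] ->.
apply: nS => j /ssrnat.leP; rewrite -ltnS => jn.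
have A0j : A 0%N j = 0.
  move/matrixP: vM => /(_ 0 (Ordinal jn)); rewrite toC0 scale0r !mxE big_ord_recl.
  rewrite big1 ?addr0 => [/eqP|i _]; last by rewrite vj mul0r.
  by rewrite mulf_eq0 (negbTE v00) mxE /= => /eqP [].
split=> //; rewrite symA //; last exact: PeanoNat.Nat.le_0_l.
by apply/ssrnat.leP.
Qed.

(** * Spectra of real symmetric matrices and the block-diagonal case *)

Lemma is_real_spectrumP k B l :
  is_real_spectrum k B l <->
  char_poly (toMx k (Defs.realM B)) = \prod_(y <- l) ('X - (y%:C)%:P).
Proof.
have evalE (x : R) : toC (Cprod (List.map (fun mu => RtoC (Rminus x mu)) l)) =
    (\prod_(y <- l) ('X - (y%:C)%:P)).[x%:C].
  rewrite horner_prod toC_Cprod !big_map; apply: eq_bigr => y _.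
  by rewrite hornerXsubC -rmorphB.
split=> [[_ eqB]|eqB].
  apply: poly_eq_on_reals => x.
  by rewrite -[x%:C]/(toC (RtoC x)) -toC_charpoly eqB evalE.
split=> [|x]; last by apply: toC_inj; rewrite toC_charpoly eqB evalE.
have := size_char_poly (toMx k (Defs.realM B)).
rewrite eqB size_prod_XsubC => -[<-].
by elim: l {eqB evalE} => //= a l ->.
Qed.

(** If x is an eigenvalue of [B], then ix is one of iB, whose real part is the zero matrix;
    [eigenvalue_real_part] gives Re(ix) = 0, so x is real. *)
Lemma real_spectrumP k B :
  (forall i j, lt i k -> lt j k -> B i j = B j i) ->
  is_real_spectrum k B (real_spectrum k B).
Proof.
move=> symB; rewrite /real_spectrum; apply: epsilon_spec.
have [r] := closed_field_poly_normal (char_poly (toMx k (Defs.realM B))).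
rewrite (monicP (char_poly_monic _)) scale1r => eqr.
have r_real x : x \in r -> (complex.Re x)%:C = x.
  rewrite -root_prod_XsubC -eqr -eigenvalue_root_char => /eigenvalueP [v vB v0].
  have vM : v *m toMx k (fun i j => (0, B i j)) = toC (ofC ('i * x)) *: v.
    rewrite ofCK -scalerA -vB scalemxAr; congr (v *m _).
    by apply/matrixP => i j; rewrite !mxE; congr (_ +i* _) => /=; rewrite ?R0E ?R1E; ring.
  have := eigenvalue_real_part _ _ _ _ _ _ vM.
  rewrite -/sqnorm /= => eqN.
  have /eqP : (complex.Re ('i * x)) * (\sum_j sqnorm (v 0 j)) = 0.
    rewrite eqN // => [|i j]; last by apply: symB; apply/ssrnat.ltP.
    by rewrite big1 // => j _; rewrite mul0r.
  rewrite mulf_eq0 (gt_eqF (sum_sqnorm_gt0 _ _ v0)) orbF mulrC ReiNIm oppr_eq0.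
  by case: x {vB vM eqN} => a b /= /eqP ->.
exists (map (@complex.Re R) r); apply/is_real_spectrumP.
by rewrite eqr big_map; apply: eq_big_seq => x /r_real ->.
Qed.

(** Expansion along row 0 splits off the root i a_00 and leaves the block I + i A^+. The corner
    entry is left free so that matrices of S and their perturbations at the corner are both
    covered. *)
Lemma block_spectrum n A : Sym n A ->
  (forall j, le 1 j -> le j n -> A 0%N j = 0) ->
  is_spectrum n.+1 (IiA A)
    ((IZR 0, A 0%N 0%N) :: List.map (fun mu => (IZR 1, mu)) (real_spectrum n (Aplus A))).
Proof.
move=> symA A0.
have [] : is_real_spectrum n (Aplus A) (real_spectrum n (Aplus A)).
  by apply: real_spectrumP => i j ? ?; apply: symA; lia.
move: (real_spectrum n (Aplus A)) => l sz_l eql; apply/is_spectrumP.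
have /is_real_spectrumP eqA : is_real_spectrum n (Aplus A) l by [].
have sz : size l = n by rewrite -sz_l; elim: (l) => //= a s ->.
apply: poly_eq_on_reals => x; set z := x%:C.
rewrite horner_char_poly (expand_det_row _ ord0) big_ord_recl big1 => [|j _]; last first.
  rewrite !mxE /= /IiA /bump /= add1n A0.
  - by rewrite mulr0n sub0r (_ : toC _ = 0) // oppr0 mul0r.
  - by apply/ssrnat.leP.
  - by apply/ssrnat.leP.
rewrite addr0 !mxE mulr1n prod_XsubC_horner big_cons; congr (_ * _).
rewrite /cofactor expr0 mul1r.
have i0 : 'i != 0 :> R[i] by rewrite eq_complex /= oner_eq0 andbF.
have iE (y : R) : 'i * ((z - 1) / 'i - y%:C) = z - toC (IZR 1, y).
  rewrite mulrBr mulrC divfK // -addrA -opprD; congr (_ - _).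
  by congr (_ +i* _) => /=; rewrite ?R0E ?R1E; ring.
(* By [iE], the characteristic polynomial of I + i A^+ at z is i^n times that of A^+ at (z -
   1)/i. *)
transitivity (\det ('i *: (((z - 1) / 'i)%:M - toMx n (Defs.realM (Aplus A))))).
  congr (\det _); apply/matrixP => i j; rewrite !mxE (inj_eq (@lift_inj _ _)) /=.
  rewrite /IiA /In_mat /Defs.realM /Aplus /= /bump /= !add1n.
  have [-> /=|ij] := eqVneq i j.
    by rewrite PeanoNat.Nat.eqb_refl !mulr1n -[toC (RtoC _)]/(_%:C) iE.
  rewrite !mulr0n !sub0r mulrN; congr (- _).
  have /negbTE -> : ~~ Nat.eqb i j.
    by apply: contra ij => /PeanoNat.Nat.eqb_eq /val_inj ->.
  by congr (_ +i* _) => /=; rewrite ?R0E ?R1E; ring.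
rewrite detZ -horner_char_poly eqA horner_prod -sz big_map.
elim: (l) => [|y s IHs]; first by rewrite !big_nil expr0 mul1r.
by rewrite !big_cons exprS -IHs -iE hornerXsubC /=; ring.
Qed.

(** * Bounding eigenvalues by the size of the entries *)

Lemma normc_real (a : R) : `|a%:C| = `|a|%:C.
Proof. by rewrite normc_def /= expr0n /= addr0 sqrtr_sqr. Qed.

Lemma normc_i : `|'i| = 1 :> R[i].
Proof. by rewrite normc_def /= expr0n /= add0r expr1n sqrtr1. Qed.

Lemma normc_le_Re_Im (x : R[i]) : `|x| <= `|complex.Re x|%:C + `|complex.Im x|%:C.
Proof.
by rewrite {1}[x]complexE (le_trans (ler_normD _ _)) // normrM normc_i mul1r !normc_real.
Qed.

Lemma normc_ge_Im (x : R[i]) : `|complex.Im x|%:C <= `|x|.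
Proof.
by have := normc_ge_Re (x * 'i); rewrite ReiNIm normrN normrM normc_i mulr1.
Qed.

(* Compares the l^1 norms of the two sides of v *m M = z *: v. *)
Lemma eigenvalue_bound k M (m : R) z :
  (forall i j, lt i k -> lt j k ->
     Rle (Rabs (fst (M i j))) m /\ Rle (Rabs (snd (M i j))) m) ->
  charpoly k M z = C0 ->
  Rle (Rabs (fst z)) (Rmult (INR k) (Rplus m m)) /\
  Rle (Rabs (snd z)) (Rmult (INR k) (Rplus m m)).
Proof.
move=> Mm /charpoly_eigenvector [v v0 vM].
have M2 (i j : 'I_k) : `|toC (M i j)| <= (m + m)%:C.
  have [] := Mm i j; try by apply/ssrnat.ltP.
  move=> /RleP Re_le /RleP Im_le; apply: le_trans (normc_le_Re_Im _) _.
  by rewrite rmorphD lerD // lecR.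
have v_gt0 : 0 < \sum_j `|v 0 j|.
  rewrite lt_neqAle sumr_ge0 // andbT; apply: contra v0 => /eqP /esym /psumr_eq0P v0.
  by apply/eqP/rowP => j; rewrite mxE; apply/normr0_eq0/v0.
have z_le : `|toC z| <= (k%:R * (m + m))%:C.
  rewrite -(ler_pM2r v_gt0) mulr_sumr.
  have -> : \sum_j `|toC z| * `|v 0 j| = \sum_(j < k) `|\sum_i v 0 i * toC (M i j)|.
    apply: eq_bigr => j _; move/matrixP: vM => /(_ 0 j); rewrite !mxE -normrM => <-.
    by congr `| _ |; apply: eq_bigr => i _; rewrite mxE.
  apply: (le_trans (ler_sum _ (fun j _ => ler_norm_sum _ _ _))).
  rewrite exchange_big mulr_sumr; apply: ler_sum => i _.
  under eq_bigr => j _ do rewrite normrM.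
  rewrite -mulr_sumr mulrC ler_wpM2r //.
  apply: (le_trans (ler_sum _ (fun j _ => M2 i j))).
  by rewrite sumr_const card_ord rmorphM rmorph_nat mulr_natl.
have E : Rmult (INR k) (Rplus m m) = k%:R * (m + m) by rewrite INRE.
rewrite E; split; apply/RleP; rewrite -lecR; apply: le_trans z_le.
  exact: normc_ge_Re (toC z).
exact: normc_ge_Im (toC z).
Qed.

End Spectra.

(** * Convergence of complex sequences and of lists of roots *)

Definition Ccv (z : nat -> C) (a : C) : Prop :=
  Un_cv (fun m => fst (z m)) (fst a) /\ Un_cv (fun m => snd (z m)) (snd a).

Lemma Un_cv_const (c : R) : Un_cv (fun _ => c) c.
Proof.
  intros eps He; exists 0%nat; intros m _.
  unfold Rdist; rewrite Rminus_diag, Rabs_R0; exact He.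
Qed.

Lemma Un_cv_eventually_eq (u v : nat -> R) (l : R) :
  (exists N, forall m, (N <= m)%nat -> u m = v m) -> Un_cv v l -> Un_cv u l.
Proof.
  intros [N HN] Hv eps He; destruct (Hv eps He) as [N' HN'].
  exists (max N N'); intros m Hm; rewrite HN by lia; apply HN'; lia.
Qed.

(** The condition [m <= phi m] stands in for strict monotonicity: it suffices for passing to limits
    and is stable under composition. *)
Lemma Un_cv_subseq (u : nat -> R) (l : R) (phi : nat -> nat) :
  (forall m, (m <= phi m)%nat) -> Un_cv u l -> Un_cv (fun m => u (phi m)) l.
Proof.
  intros Hphi Hu eps He; destruct (Hu eps He) as [N HN].
  exists N; intros m Hm; apply HN; specialize (Hphi m); lia.
Qed.

Lemma Un_cv_continuous (g : R -> R) (u : nat -> R) (l : R) :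
  continuity_pt g l -> Un_cv u l -> Un_cv (fun m => g (u m)) (g l).
Proof. intros Hg Hu; exact (continuity_seq g u l Hg Hu). Qed.

Lemma Un_cv_eventually_pos (u : nat -> R) (l : R) :
  Un_cv u l -> 0 < l -> exists N, forall m, (N <= m)%nat -> 0 < u m.
Proof.
  intros Hu Hl; destruct (Hu l Hl) as [N HN]; exists N; intros m Hm.
  specialize (HN m Hm); unfold Rdist in HN; apply Rabs_def2 in HN; lra.
Qed.

Lemma Un_cv_div (u v : nat -> R) (a b : R) :
  Un_cv u a -> Un_cv v b -> b <> 0 -> Un_cv (fun m => u m / v m) (a / b).
Proof.
  intros Hu Hv Hb; apply CV_mult; [exact Hu|].
  apply (Un_cv_continuous Rinv); [|exact Hv].
  apply continuity_pt_inv; [|exact Hb].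
  apply derivable_continuous_pt; apply derivable_pt_id.
Qed.

Lemma Ccv_const (a : C) : Ccv (fun _ => a) a.
Proof. split; apply Un_cv_const. Qed.

Lemma Ccv_subseq (z : nat -> C) (a : C) (phi : nat -> nat) :
  (forall m, (m <= phi m)%nat) -> Ccv z a -> Ccv (fun m => z (phi m)) a.
Proof.
  intros Hphi [H1 H2]; split.
  - exact (Un_cv_subseq _ _ _ Hphi H1).
  - exact (Un_cv_subseq _ _ _ Hphi H2).
Qed.

Lemma Ccv_add (z w : nat -> C) (a b : C) :
  Ccv z a -> Ccv w b -> Ccv (fun m => Cadd (z m) (w m)) (Cadd a b).
Proof. intros [? ?] [? ?]; split; apply CV_plus; assumption. Qed.

Lemma Ccv_opp (z : nat -> C) (a : C) : Ccv z a -> Ccv (fun m => Copp (z m)) (Copp a).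
Proof. intros [? ?]; split; apply CV_opp; assumption. Qed.

Lemma Ccv_mul (z w : nat -> C) (a b : C) :
  Ccv z a -> Ccv w b -> Ccv (fun m => Cmul (z m) (w m)) (Cmul a b).
Proof.
  intros [? ?] [? ?]; split.
  - apply CV_minus; apply CV_mult; assumption.
  - apply CV_plus; apply CV_mult; assumption.
Qed.

Lemma Ccv_unique (z : nat -> C) (a b : C) : Ccv z a -> Ccv z b -> a = b.
Proof.
  intros [H1 H2] [H3 H4]; destruct a as [a1 a2], b as [b1 b2]; simpl in *.
  f_equal; [exact (UL_sequence _ _ _ H1 H3) | exact (UL_sequence _ _ _ H2 H4)].
Qed.

Lemma Ccv_Csum (k : nat) (f : nat -> nat -> C) (g : nat -> C) :
  (forall j, (j < k)%nat -> Ccv (fun m => f m j) (g j)) ->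
  Ccv (fun m => Csum k (f m)) (Csum k g).
Proof.
  induction k as [|k IH]; intros H; simpl; [apply Ccv_const|].
  apply Ccv_add; [apply IH; intros j Hj; apply H; lia | apply H; lia].
Qed.

Lemma Ccv_det (k : nat) (Ms : nat -> CMat) (M : CMat) :
  (forall i j, (i < k)%nat -> (j < k)%nat -> Ccv (fun m => Ms m i j) (M i j)) ->
  Ccv (fun m => det k (Ms m)) (det k M).
Proof.
  revert Ms M; induction k as [|k IH]; intros Ms M H; [exact (Ccv_const C1)|].
  apply (Ccv_Csum (S k) (fun m j => Cmul (if Nat.even j then C1 else Copp C1)
    (Cmul (Ms m 0%nat j) (det k (minor j (Ms m)))))).
  intros j Hj; apply Ccv_mul; [apply Ccv_const|].
  apply Ccv_mul; [apply H; lia|].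
  apply IH; intros r c Hr Hc; unfold minor.
  destruct (Nat.ltb c j); apply H; lia.
Qed.

Lemma Ccv_charpoly (k : nat) (Ms : nat -> CMat) (M : CMat) (z : C) :
  (forall i j, (i < k)%nat -> (j < k)%nat -> Ccv (fun m => Ms m i j) (M i j)) ->
  Ccv (fun m => charpoly k (Ms m) z) (charpoly k M z).
Proof.
  intros H; apply Ccv_det; intros i j Hi Hj; destruct (Nat.eqb i j).
  - apply Ccv_add; [apply Ccv_const | apply Ccv_opp; apply H; assumption].
  - apply Ccv_opp; apply H; assumption.
Qed.

(** [Bolzano_Weierstrass] provides a cluster point; picking for each m an index beyond m with
    distance below 1/(m+1) turns it into the limit of a subsequence. *)
Lemma bounded_subseq (u : nat -> R) (K : R) :
  (forall m, Rabs (u m) <= K) ->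
  exists phi l, (forall m, (m <= phi m)%nat) /\ Un_cv (fun m => u (phi m)) l.
Proof.
  intros HK.
  destruct (Bolzano_Weierstrass u (fun c => - K <= c <= K)) as [l Hl].
  - apply compact_P3.
  - intros m; specialize (HK m); unfold Rabs in HK; destruct Rcase_abs; lra.
  - assert (Hex : forall m, { p : nat | (m <= p)%nat /\ Rabs (u p - l) < / INR (S m) }).
    { intros m; apply constructive_indefinite_description.
      assert (Hpos : 0 < / INR (S m)) by (apply Rinv_0_lt_compat; apply lt_0_INR; lia).
      destruct (Hl (fun y => Rabs (y - l) < / INR (S m)) m) as [p Hp].
      - exists (mkposreal _ Hpos); intros y Hy; exact Hy.
      - exists p; exact Hp. }
    exists (fun m => proj1_sig (Hex m)), l; split.
    + intros m; exact (proj1 (proj2_sig (Hex m))).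
    + intros eps He.
      destruct (archimed_cor1 eps He) as [N [HN HN0]].
      exists N; intros m Hm; unfold Rdist.
      apply Rlt_trans with (/ INR (S m)); [exact (proj2 (proj2_sig (Hex m)))|].
      apply Rle_lt_trans with (/ INR N); [|exact HN].
      apply Rinv_le_contravar; [apply lt_0_INR; lia | apply le_INR; lia].
Qed.

(** Entrywise convergence; recursion on the limit forces every list of the sequence to have its
    length. *)
Fixpoint Lcv (ls : nat -> list C) (l : list C) : Prop :=
  match l with
  | nil => forall m, ls m = nil
  | a :: l' => exists zs lss, (forall m, ls m = zs m :: lss m) /\ Ccv zs a /\ Lcv lss l'
  end.

(** Successive extractions: for the real part of the head, for its imaginary part, and by induction
    for the tail. *)
Lemma bounded_list_subseq (K : R) (k : nat) (ls : nat -> list C) :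
  (forall m, length (ls m) = k) ->
  (forall m z, In z (ls m) -> Rabs (fst z) <= K /\ Rabs (snd z) <= K) ->
  exists phi l, (forall m, (m <= phi m)%nat) /\ Lcv (fun m => ls (phi m)) l.
Proof.
  revert ls; induction k as [|k IH]; intros ls Hlen HK.
  - exists (fun m => m), nil; split; [lia|].
    intros m; apply length_zero_iff_nil; apply Hlen.
  - assert (Hcons : forall m, ls m = hd C0 (ls m) :: tl (ls m)).
    { intros m; specialize (Hlen m); destruct (ls m); [discriminate | reflexivity]. }
    assert (Hhd : forall m, In (hd C0 (ls m)) (ls m)).
    { intros m; rewrite Hcons at 2; left; reflexivity. }
    destruct (bounded_subseq (fun m => fst (hd C0 (ls m))) K) as [p1 [x [Hp1 Hx]]].
    { intros m; exact (proj1 (HK _ _ (Hhd m))). }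
    destruct (bounded_subseq (fun m => snd (hd C0 (ls (p1 m)))) K) as [p2 [y [Hp2 Hy]]].
    { intros m; exact (proj2 (HK _ _ (Hhd (p1 m)))). }
    destruct (IH (fun m => tl (ls (p1 (p2 m))))) as [p3 [l [Hp3 Hl]]].
    { intros m; specialize (Hlen (p1 (p2 m))); rewrite Hcons in Hlen.
      injection Hlen; auto. }
    { intros m z Hz; apply (HK (p1 (p2 m))); rewrite Hcons; right; exact Hz. }
    exists (fun m => p1 (p2 (p3 m))), ((x, y) :: l); split.
    { intros m; specialize (Hp3 m); specialize (Hp2 (p3 m));
        specialize (Hp1 (p2 (p3 m))); lia. }
    exists (fun m => hd C0 (ls (p1 (p2 (p3 m))))), (fun m => tl (ls (p1 (p2 (p3 m))))).
    split; [intros m; apply Hcons|]; split; [|exact Hl].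
    apply (Ccv_subseq (fun m => hd C0 (ls (p1 (p2 m)))) (x, y) p3 Hp3); split; simpl.
    + exact (Un_cv_subseq _ _ p2 Hp2 Hx).
    + exact Hy.
Qed.

Lemma Lcv_length (ls : nat -> list C) (l : list C) :
  Lcv ls l -> forall m, length (ls m) = length l.
Proof.
  revert ls; induction l as [|a l IH]; simpl; intros ls H m; [now rewrite H|].
  destruct H as [zs [lss [Hls [_ H]]]]; rewrite Hls; simpl; now rewrite (IH lss H m).
Qed.

Lemma Lcv_prod (ls : nat -> list C) (l : list C) (z : C) :
  Lcv ls l ->
  Ccv (fun m => Cprod (map (fun lam => Csub z lam) (ls m)))
      (Cprod (map (fun lam => Csub z lam) l)).
Proof.
  revert ls; induction l as [|a l IH]; simpl; intros ls H.
  - split; apply (Un_cv_eventually_eq _ _ _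
      (ex_intro _ 0%nat (fun m _ => f_equal (fun s => _ (Cprod (map _ s))) (H m))));
      apply Un_cv_const.
  - destruct H as [zs [lss [Hls [Hzs H]]]].
    assert (Hcv : Ccv
      (fun m => Cmul (Csub z (zs m)) (Cprod (map (fun lam => Csub z lam) (lss m))))
      (Cmul (Csub z a) (Cprod (map (fun lam => Csub z lam) l)))).
    { apply Ccv_mul; [|exact (IH lss H)].
      apply Ccv_add; [apply Ccv_const | apply Ccv_opp; exact Hzs]. }
    destruct Hcv as [H1 H2]; split.
    + refine (Un_cv_eventually_eq _ _ _ _ H1); exists 0%nat; intros m _; now rewrite Hls.
    + refine (Un_cv_eventually_eq _ _ _ _ H2); exists 0%nat; intros m _; now rewrite Hls.
Qed.

(** * Semicontinuity of spectral sums *)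

(** Only sequences in the closed right half-plane are tested, since the spectra lie there. On the
    whole plane the argument with value [PI / 2] at 0 would fail the condition at 0. *)
Definition usc_at (g : C -> R) (a : C) : Prop :=
  forall zs, Ccv zs a -> (forall m, 0 <= fst (zs m)) ->
  forall eps, 0 < eps -> exists N, forall m, (N <= m)%nat -> g (zs m) < g a + eps.

Lemma Lcv_usc_sum (g : C -> R) (ls : nat -> list C) (l : list C) :
  Lcv ls l -> (forall a, In a l -> usc_at g a) ->
  (forall m z, In z (ls m) -> 0 <= fst z) ->
  forall eps, 0 < eps -> exists N, forall m, (N <= m)%nat ->
    Rlsum (map g (ls m)) < Rlsum (map g l) + eps.
Proof.
  revert ls; induction l as [|a l IH]; simpl; intros ls H Hg Hre eps He.
  - exists 0%nat; intros m _; rewrite H; simpl; lra.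
  - destruct H as [zs [lss [Hls [Hzs H]]]].
    destruct (IH lss H) with (eps := eps / 2) as [N1 HN1]; [auto| |lra|].
    { intros m z Hz; apply (Hre m); rewrite Hls; right; exact Hz. }
    destruct (Hg a (or_introl eq_refl) zs Hzs) with (eps := eps / 2) as [N2 HN2]; [|lra|].
    { intros m; apply (Hre m); rewrite Hls; left; reflexivity. }
    exists (max N1 N2); intros m Hm; rewrite Hls; simpl.
    specialize (HN1 m ltac:(lia)); specialize (HN2 m ltac:(lia)).
    unfold Rlsum in *; lra.
Qed.

Lemma sum_f_R0_nonneg (f : nat -> R) (n : nat) : (forall i, 0 <= f i) -> 0 <= sum_f_R0 f n.
Proof.
  intros Hf; induction n as [|n IH]; simpl; [apply Hf | specialize (Hf (S n)); lra].
Qed.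

Lemma sum_f_R0_ge_term (f : nat -> R) (n i : nat) :
  (forall i, 0 <= f i) -> (i <= n)%nat -> f i <= sum_f_R0 f n.
Proof.
  intros Hf; induction n as [|n IH]; intros Hi; simpl.
  - replace i with 0%nat by lia; lra.
  - destruct (Nat.eq_dec i (S n)) as [->|Hne].
    + pose proof (sum_f_R0_nonneg f n Hf); lra.
    + specialize (IH ltac:(lia)); specialize (Hf (S n)); lra.
Qed.

Lemma entry_le_mdist (n : nat) (A B : Mat) (i j : nat) :
  (i <= n)%nat -> (j <= n)%nat -> Rabs (A i j - B i j) <= mdist n A B.
Proof.
  intros Hi Hj; unfold mdist; rewrite <- sqrt_Rsqr_abs; apply sqrt_le_1_alt.
  assert (Hin : forall i j, 0 <= (A i j - B i j) ^ 2) by (intros; apply pow2_ge_0).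
  rewrite Rsqr_pow2.
  apply Rle_trans with (sum_f_R0 (fun j => (A i j - B i j) ^ 2) n).
  - apply (sum_f_R0_ge_term (fun j => (A i j - B i j) ^ 2)); auto.
  - apply (sum_f_R0_ge_term (fun i => sum_f_R0 (fun j => (A i j - B i j) ^ 2) n)); auto.
    intros i'; apply sum_f_R0_nonneg; auto.
Qed.

Lemma entry_bound (n : nat) (A : Mat) :
  exists K, forall i j, (i <= n)%nat -> (j <= n)%nat -> Rabs (A i j) <= K.
Proof.
  exists (mdist n A mzero); intros i j Hi Hj.
  rewrite <- (Rminus_0_r (A i j)); exact (entry_le_mdist n A mzero i j Hi Hj).
Qed.

Lemma spectrum_re_ge0 (n : nat) (A : Mat) (z : C) :
  Sym n A -> In z (spectrum (S n) (IiA A)) -> 0 <= fst z.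
Proof.
  intros HA Hz; apply (Spectra.eigenvalue_re_ge0 n A z HA).
  exact (Spectra.in_spectrum_charpoly _ _ _ _ (Spectra.spectrumP _ _) Hz).
Qed.

(* Along matrices converging to A the spectra stay bounded, and by uniqueness of the
   factorisation any limit of a convergent subsequence is the spectrum of A. *)
Lemma spectral_sum_usc (n : nat) (g : C -> R) (A : Mat) :
  (forall a, is_eigenvalue n A a -> usc_at g a) ->
  forall eps, 0 < eps -> exists delta, 0 < delta /\
    forall B, Sym n B -> mdist n A B < delta ->
      Rlsum (map g (spectrum (S n) (IiA B))) <
      Rlsum (map g (spectrum (S n) (IiA A))) + eps.
Proof.
  intros Hg eps He; apply NNPP; intros Hno.
  (* Failure for every radius 1/(m+1) yields counterexamples that converge to [A]. *)
  assert (Hex : forall m, { B : Mat | Sym n B /\ mdist n A B < / INR (S m) /\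
    Rlsum (map g (spectrum (S n) (IiA A))) + eps <=
    Rlsum (map g (spectrum (S n) (IiA B))) }).
  { intros m; apply constructive_indefinite_description; apply NNPP; intros Hm.
    apply Hno; exists (/ INR (S m)); split.
    - apply Rinv_0_lt_compat; apply lt_0_INR; lia.
    - intros B HB HAB; apply Rnot_le_lt; intros Hle; apply Hm; exists B; auto. }
  set (Bs := fun m => proj1_sig (Hex m)).
  assert (HBs : forall m, Sym n (Bs m) /\ mdist n A (Bs m) < / INR (S m) /\
    Rlsum (map g (spectrum (S n) (IiA A))) + eps <=
    Rlsum (map g (spectrum (S n) (IiA (Bs m))))) by (intros m; exact (proj2_sig (Hex m))).
  clearbody Bs; clear Hex Hno.
  assert (Hcv : forall i j, (i < S n)%nat -> (j < S n)%nat ->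
    Ccv (fun m => IiA (Bs m) i j) (IiA A i j)).
  { intros i j Hi Hj; split; simpl; [apply Un_cv_const|].
    intros e He'; destruct (archimed_cor1 e He') as [N [HN HN0]].
    exists N; intros m Hm; unfold Rdist; rewrite Rabs_minus_sym.
    apply Rle_lt_trans with (mdist n A (Bs m)); [apply entry_le_mdist; lia|].
    apply Rlt_trans with (/ INR (S m)); [apply HBs|].
    apply Rle_lt_trans with (/ INR N); [|exact HN].
    apply Rinv_le_contravar; [apply lt_0_INR; lia | apply le_INR; lia]. }
  destruct (entry_bound n A) as [K HK].
  (* All [Bs m] lie within distance 1 of [A], so [K + 1] bounds their entries; it also bounds the
     entries 0 and 1 of [In_mat]. *)
  destruct (bounded_list_subseq (INR (S n) * ((K + 1) + (K + 1))) (S n)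
    (fun m => spectrum (S n) (IiA (Bs m)))) as [phi [l [Hphi Hl]]].
  { intros m; apply Spectra.spectrumP. }
  { intros m z Hz.
    apply (Spectra.eigenvalue_bound (S n) (IiA (Bs m)));
      [|exact (Spectra.in_spectrum_charpoly _ _ _ _ (Spectra.spectrumP _ _) Hz)].
    intros i j Hi Hj.
    assert (HKij : Rabs (A i j) <= K) by (apply HK; lia).
    pose proof (Rabs_pos (A i j)) as Hpos; split; simpl.
    - unfold In_mat; destruct (_ && _)%bool; [rewrite Rabs_R1 | rewrite Rabs_R0]; lra.
    - assert (Hd : Rabs (A i j - Bs m i j) <= mdist n A (Bs m)) by (apply entry_le_mdist; lia).
      assert (Hm : mdist n A (Bs m) < / INR (S m)) by apply HBs.
      assert (H1 : / INR (S m) <= / 1).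
      { apply Rinv_le_contravar; [lra|]; rewrite S_INR; pose proof (pos_INR m); lra. }
      rewrite Rabs_minus_sym in Hd.
      pose proof (Rabs_triang (A i j) (Bs m i j - A i j)) as Ht.
      replace (A i j + (Bs m i j - A i j)) with (Bs m i j) in Ht by ring; lra. }
  assert (Hspec : is_spectrum (S n) (IiA A) l).
  { split.
    - rewrite <- (Lcv_length _ _ Hl 0%nat); apply Spectra.spectrumP.
    - intros z.
      apply (Ccv_unique (fun m => charpoly (S n) (IiA (Bs (phi m))) z)).
      + apply Ccv_charpoly; intros i j Hi Hj.
        exact (Ccv_subseq _ _ phi Hphi (Hcv i j Hi Hj)).
      + destruct (Lcv_prod _ _ z Hl) as [H1 H2]; split.
        * refine (Un_cv_eventually_eq _ _ _ _ H1); exists 0%nat; intros m _.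
          now rewrite (proj2 (Spectra.spectrumP (S n) (IiA (Bs (phi m))))).
        * refine (Un_cv_eventually_eq _ _ _ _ H2); exists 0%nat; intros m _.
          now rewrite (proj2 (Spectra.spectrumP (S n) (IiA (Bs (phi m))))). }
  destruct (Lcv_usc_sum g _ l Hl) with (eps := eps) as [N HN].
  - intros a Ha; apply Hg; exact (Spectra.in_spectrum_charpoly _ _ _ _ Hspec Ha).
  - intros m z Hz; exact (spectrum_re_ge0 n _ z (proj1 (HBs (phi m))) Hz).
  - exact He.
  - specialize (HN N (le_n N)).
    (* The limit list [l] may be ordered differently from the chosen spectrum of [A], but the sums
       agree. *)
    rewrite (Spectra.spectrum_sum_unique _ _ _ _ g Hspec (Spectra.spectrumP _ _)) in HN.
    pose proof (proj2 (proj2 (HBs (phi N)))); lra.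
Qed.

(** * The argument on the closed right half-plane *)

Lemma Carg_re_pos (z : C) : 0 < fst z -> Carg z = atan (snd z / fst z).
Proof. intros H; unfold Carg; destruct (Rlt_dec 0 (fst z)); [reflexivity | contradiction]. Qed.

(** The reciprocal form of the arctangent stays valid on the imaginary axis, where y/x breaks down,
    and so shows continuity there. *)
Lemma Carg_im_pos (z : C) :
  0 <= fst z -> 0 < snd z -> Carg z = PI / 2 - atan (fst z / snd z).
Proof.
  intros Hx Hy; destruct (Rle_lt_or_eq_dec _ _ Hx) as [Hx'|Hx'].
  - rewrite Carg_re_pos by exact Hx'.
    replace (snd z / fst z) with (/ (fst z / snd z)) by (field; lra).
    apply atan_inv; apply Rdiv_lt_0_compat; assumption.
  - unfold Carg; rewrite <- Hx'.
    destruct (Rlt_dec 0 0); [lra|]; destruct (Rlt_dec 0 (snd z)); [|lra].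
    rewrite Rdiv_0_l, atan_0; lra.
Qed.

Lemma Carg_im_neg (z : C) :
  0 <= fst z -> snd z < 0 -> Carg z = - (PI / 2) - atan (fst z / snd z).
Proof.
  intros Hx Hy; destruct (Rle_lt_or_eq_dec _ _ Hx) as [Hx'|Hx'].
  - rewrite Carg_re_pos by exact Hx'.
    replace (snd z / fst z) with (- / (fst z / - snd z)) by (field; lra).
    rewrite atan_opp, atan_inv by (apply Rdiv_lt_0_compat; lra).
    replace (fst z / - snd z) with (- (fst z / snd z)) by (field; lra).
    rewrite atan_opp; lra.
  - unfold Carg; rewrite <- Hx'.
    destruct (Rlt_dec 0 0); [lra|]; destruct (Rlt_dec 0 (snd z)); [lra|].
    destruct (Rlt_dec (snd z) 0); [|lra].
    rewrite Rdiv_0_l, atan_0; lra.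
Qed.

Lemma Carg_bound (z : C) : 0 <= fst z -> - (PI / 2) <= Carg z <= PI / 2.
Proof.
  intros Hx; pose proof PI_RGT_0 as HPI.
  destruct (Rle_lt_or_eq_dec _ _ Hx) as [Hx'|Hx'].
  - rewrite Carg_re_pos by exact Hx'; pose proof (atan_bound (snd z / fst z)); lra.
  - unfold Carg; rewrite <- Hx'.
    destruct (Rlt_dec 0 0); [lra|]; destruct (Rlt_dec 0 (snd z)); [lra|].
    destruct (Rlt_dec (snd z) 0); lra.
Qed.

Lemma atan_continuous (x : R) : continuity_pt atan x.
Proof. apply derivable_continuous_pt; apply derivable_pt_atan. Qed.

Lemma nonzero_cases (a : C) : 0 <= fst a -> a <> C0 -> 0 < fst a \/ 0 < snd a \/ snd a < 0.
Proof.
  intros Hx Ha; destruct a as [x y]; simpl in *.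
  destruct (Rtotal_order y 0) as [Hy|[Hy|Hy]]; auto.
  left; destruct Hx as [Hx|Hx]; [exact Hx|]; exfalso; apply Ha; now subst.
Qed.

(** The regions Re > 0, Im > 0 and Im < 0 cover the half-plane without 0; on each a single
    continuous formula for the argument holds, and the sequence eventually stays in the region of
    its limit. *)
Lemma Carg_cv (zs : nat -> C) (a : C) :
  0 <= fst a -> a <> C0 -> (forall m, 0 <= fst (zs m)) -> Ccv zs a ->
  Un_cv (fun m => Carg (zs m)) (Carg a).
Proof.
  intros Ha Ha0 Hzs [Hx Hy].
  destruct (nonzero_cases a Ha Ha0) as [Hp|[Hp|Hp]].
  - rewrite Carg_re_pos by exact Hp.
    apply (Un_cv_eventually_eq _ (fun m => atan (snd (zs m) / fst (zs m)))).
    + destruct (Un_cv_eventually_pos _ _ Hx Hp) as [N HN]; exists N; intros m Hm.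
      apply Carg_re_pos; auto.
    + apply (Un_cv_continuous atan); [apply atan_continuous|].
      apply Un_cv_div; auto; lra.
  - rewrite Carg_im_pos by auto.
    apply (Un_cv_eventually_eq _ (fun m => PI / 2 - atan (fst (zs m) / snd (zs m)))).
    + destruct (Un_cv_eventually_pos _ _ Hy Hp) as [N HN]; exists N; intros m Hm.
      apply Carg_im_pos; auto.
    + apply CV_minus; [apply Un_cv_const|].
      apply (Un_cv_continuous atan); [apply atan_continuous|].
      apply Un_cv_div; auto; lra.
  - rewrite Carg_im_neg by auto.
    apply (Un_cv_eventually_eq _ (fun m => - (PI / 2) - atan (fst (zs m) / snd (zs m)))).
    + destruct (Un_cv_eventually_pos _ _ (CV_opp _ _ Hy)) as [N HN]; [lra|].
      exists N; intros m Hm; apply Carg_im_neg; auto.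
      specialize (HN m Hm); unfold opp_seq in HN; lra.
    + apply CV_minus; [apply Un_cv_const|].
      apply (Un_cv_continuous atan); [apply atan_continuous|].
      apply Un_cv_div; auto; lra.
Qed.

(** Prescribing the value at 0 makes both extensions of [Theta_hat] plain spectral sums, with [c]
    equal to [PI / 2] or [- (PI / 2)]. *)
Definition arg_at0 (c : R) (z : C) : R :=
  if excluded_middle_informative (z = C0) then c else Carg z.

Lemma arg_at0_0 (c : R) : arg_at0 c C0 = c.
Proof. unfold arg_at0; destruct excluded_middle_informative; congruence. Qed.

Lemma arg_at0_neq0 (c : R) (z : C) : z <> C0 -> arg_at0 c z = Carg z.
Proof. intros H; unfold arg_at0; destruct excluded_middle_informative; congruence. Qed.

Lemma Ccv_eventually_neq0 (zs : nat -> C) (a : C) :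
  0 <= fst a -> a <> C0 -> Ccv zs a -> exists N, forall m, (N <= m)%nat -> zs m <> C0.
Proof.
  intros Ha Ha0 [Hx Hy].
  destruct (nonzero_cases a Ha Ha0) as [Hp|[Hp|Hp]].
  - destruct (Un_cv_eventually_pos _ _ Hx Hp) as [N HN]; exists N; intros m Hm H0.
    specialize (HN m Hm); rewrite H0 in HN; simpl in HN; lra.
  - destruct (Un_cv_eventually_pos _ _ Hy Hp) as [N HN]; exists N; intros m Hm H0.
    specialize (HN m Hm); rewrite H0 in HN; simpl in HN; lra.
  - destruct (Un_cv_eventually_pos _ _ (CV_opp _ _ Hy)) as [N HN]; [lra|].
    exists N; intros m Hm H0.
    specialize (HN m Hm); unfold opp_seq in HN; rewrite H0 in HN; simpl in HN; lra.
Qed.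

Lemma arg_at0_cv (c : R) (zs : nat -> C) (a : C) :
  0 <= fst a -> a <> C0 -> (forall m, 0 <= fst (zs m)) -> Ccv zs a ->
  Un_cv (fun m => arg_at0 c (zs m)) (arg_at0 c a).
Proof.
  intros Ha Ha0 Hzs Hcv; rewrite arg_at0_neq0 by exact Ha0.
  apply (Un_cv_eventually_eq _ (fun m => Carg (zs m))); [|apply Carg_cv; assumption].
  destruct (Ccv_eventually_neq0 zs a Ha Ha0 Hcv) as [N HN]; exists N; intros m Hm.
  apply arg_at0_neq0; auto.
Qed.

Lemma cv_usc_at (g : C -> R) (a : C) :
  (forall zs, (forall m, 0 <= fst (zs m)) -> Ccv zs a ->
     Un_cv (fun m => g (zs m)) (g a)) -> usc_at g a.
Proof.
  intros H zs Hcv Hzs eps He; destruct (H zs Hzs Hcv eps He) as [N HN].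
  exists N; intros m Hm; specialize (HN m Hm); unfold Rdist in HN.
  apply Rabs_def2 in HN; lra.
Qed.

(** At 0 the prescribed value is the maximum of the argument on the half-plane; at other points the
    argument is continuous. *)
Lemma usc_arg_upper (a : C) : 0 <= fst a -> usc_at (arg_at0 (PI / 2)) a.
Proof.
  intros Ha; destruct (excluded_middle_informative (a = C0)) as [H0|H0].
  - intros zs _ Hzs eps He; exists 0%nat; intros m _; rewrite H0, arg_at0_0.
    unfold arg_at0; destruct excluded_middle_informative; [lra|].
    pose proof (Carg_bound _ (Hzs m)); lra.
  - apply cv_usc_at; intros zs Hzs Hcv; apply arg_at0_cv; assumption.
Qed.

(** The sign turns lower into upper semicontinuity, so that [spectral_sum_usc] serves both
    extensions. *)
Lemma usc_arg_lower (a : C) : 0 <= fst a -> usc_at (fun z => - arg_at0 (- (PI / 2)) z) a.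
Proof.
  intros Ha; destruct (excluded_middle_informative (a = C0)) as [H0|H0].
  - intros zs _ Hzs eps He; exists 0%nat; intros m _; rewrite H0, arg_at0_0.
    unfold arg_at0; destruct excluded_middle_informative; [lra|].
    pose proof (Carg_bound _ (Hzs m)); lra.
  - apply cv_usc_at; intros zs Hzs Hcv.
    apply (CV_opp (fun m => arg_at0 (- (PI / 2)) (zs m))); apply arg_at0_cv; assumption.
Qed.

Lemma Rlsum_map_opp {T : Type} (g : T -> R) (l : list T) :
  Rlsum (map (fun z => - g z) l) = - Rlsum (map g l).
Proof.
  induction l as [|a l IH]; simpl; [lra|]; unfold Rlsum in *; rewrite IH; lra.
Qed.

(** * Semicontinuity and extremality *)

Lemma spectrum_neq0 (n : nat) (A : Mat) (z : C) :
  Sym n A -> ~ in_S n A -> In z (spectrum (S n) (IiA A)) -> z <> C0.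
Proof.
  intros HA HS Hz H0; subst; apply (Spectra.eigenvalue_neq0 n A HA HS).
  exact (Spectra.in_spectrum_charpoly _ _ _ _ (Spectra.spectrumP _ _) Hz).
Qed.

(** The eigenvalues 1 + i mu of the block have argument arctan mu and sum to the trace term; the
    corner contributes the rest. *)
Lemma block_spectral_sum (n : nat) (A : Mat) (c : R) :
  Sym n A -> (forall j, (1 <= j)%nat -> (j <= n)%nat -> A 0%nat j = 0) ->
  Rlsum (map (arg_at0 c) (spectrum (S n) (IiA A))) =
  arg_at0 c (0, A 0%nat 0%nat) + tr_atan n A.
Proof.
  intros HA H0.
  rewrite (Spectra.spectrum_sum_unique _ _ _ _ (arg_at0 c) (Spectra.spectrumP _ _)
    (Spectra.block_spectrum n A HA H0)).
  unfold Rlsum; cbn [map fold_right]; rewrite map_map; f_equal.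
  unfold tr_atan, Rlsum; f_equal.
  apply map_ext; intros mu; rewrite arg_at0_neq0.
  - rewrite Carg_re_pos by (simpl; lra); simpl; f_equal; field.
  - intros H; injection H; lra.
Qed.

Lemma Theta_hat_arg_at0 (n : nat) (A : Mat) (c : R) :
  Sym n A -> ~ in_S n A ->
  Theta_hat n A = Rlsum (map (arg_at0 c) (spectrum (S n) (IiA A))).
Proof.
  intros HA HS; unfold Theta_hat; f_equal; apply map_ext_in; intros z Hz.
  symmetry; apply arg_at0_neq0; exact (spectrum_neq0 n A z HA HS Hz).
Qed.

(** On S the corner eigenvalue is 0 and contributes [c]; off S no eigenvalue is 0. The left side is
    the common shape of [Theta_tilde] and [Theta_tilde_low]. *)
Lemma extension_arg_at0 (n : nat) (A : Mat) (c : R) :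
  Sym n A ->
  (if excluded_middle_informative (in_S n A) then c + tr_atan n A else Theta_hat n A) =
  Rlsum (map (arg_at0 c) (spectrum (S n) (IiA A))).
Proof.
  intros HA; destruct excluded_middle_informative as [HS|HS].
  - rewrite block_spectral_sum; [|exact HA|intros j _ Hj; apply HS; exact Hj].
    destruct (HS 0%nat) as [H00 _]; [lia|]; rewrite H00.
    change (0, 0) with C0; now rewrite arg_at0_0.
  - apply Theta_hat_arg_at0; assumption.
Qed.

Lemma usc_Theta_tilde (n : nat) : usc_on_Sym n (Theta_tilde n).
Proof.
  intros A HA eps He.
  destruct (spectral_sum_usc n (arg_at0 (PI / 2)) A) with (eps := eps)
    as [delta [Hd H]]; [|exact He|].
  - intros a Ha; apply usc_arg_upper; exact (Spectra.eigenvalue_re_ge0 n A a HA Ha).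
  - exists delta; split; [exact Hd|]; intros B HB HAB.
    unfold Theta_tilde; rewrite !extension_arg_at0 by assumption; auto.
Qed.

Lemma lsc_Theta_tilde_low (n : nat) : lsc_on_Sym n (Theta_tilde_low n).
Proof.
  intros A HA eps He.
  destruct (spectral_sum_usc n (fun z => - arg_at0 (- (PI / 2)) z) A) with (eps := eps)
    as [delta [Hd H]]; [|exact He|].
  - intros a Ha; apply usc_arg_lower; exact (Spectra.eigenvalue_re_ge0 n A a HA Ha).
  - exists delta; split; [exact Hd|]; intros B HB HAB.
    unfold Theta_tilde_low; rewrite !extension_arg_at0 by assumption.
    specialize (H B HB HAB); rewrite !Rlsum_map_opp in H; lra.
Qed.

Definition shift00 (t : R) (A : Mat) : Mat :=
  fun i j => match i, j with 0%nat, 0%nat => A 0%nat 0%nat + t | _, _ => A i j end.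

Lemma sum_f_R0_only_first (f : nat -> R) (n : nat) :
  (forall i, f (S i) = 0) -> sum_f_R0 f n = f 0%nat.
Proof. intros Hf; induction n as [|n IH]; simpl; [reflexivity | rewrite IH, Hf; lra]. Qed.

Lemma mdist_shift00 (n : nat) (t : R) (A : Mat) : mdist n A (shift00 t A) = Rabs t.
Proof.
  unfold mdist; rewrite sum_f_R0_only_first.
  - rewrite sum_f_R0_only_first; [|intros i; simpl; ring].
    rewrite <- sqrt_Rsqr_abs; f_equal; simpl; unfold Rsqr; ring.
  - intros i; rewrite sum_f_R0_only_first; simpl; [|intros j]; ring.
Qed.

Lemma shift00_Sym (n : nat) (t : R) (A : Mat) : Sym n A -> Sym n (shift00 t A).
Proof. intros HA [|i] [|j] Hi Hj; simpl; try reflexivity; apply HA; assumption. Qed.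

(** Row 0 remains zero off the corner, so the block spectrum applies: the eigenvalue 0 moves to it
    and the others stay. *)
Lemma Theta_hat_shift00 (n : nat) (t : R) (A : Mat) :
  Sym n A -> in_S n A -> t <> 0 ->
  ~ in_S n (shift00 t A) /\ Theta_hat n (shift00 t A) = Carg (0, t) + tr_atan n A.
Proof.
  intros HA HS Ht.
  assert (H00 : A 0%nat 0%nat = 0) by (apply HS; lia).
  assert (HS' : ~ in_S n (shift00 t A)).
  { intros H; destruct (H 0%nat) as [H1 _]; [lia|]; simpl in H1; lra. }
  split; [exact HS'|].
  rewrite (Theta_hat_arg_at0 n _ 0 (shift00_Sym n t A HA) HS').
  rewrite block_spectral_sum; [|apply shift00_Sym; exact HA|].
  - simpl; rewrite H00, Rplus_0_l, arg_at0_neq0; [reflexivity|].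
    intros H; injection H; exact Ht.
  - intros [|j] Hj Hjn; [lia|]; simpl; apply HS; exact Hjn.
Qed.

(** Along A + t e_00 with t > 0 the values of [f] are constantly PI/2 plus the trace term; a smaller
    value at [A] would contradict upper semicontinuity with the gap as tolerance. *)
Lemma Theta_tilde_least (n : nat) (f : Mat -> R) :
  usc_on_Sym n f -> (forall A, Sym n A -> ~ in_S n A -> f A = Theta_hat n A) ->
  forall A, Sym n A -> Theta_tilde n A <= f A.
Proof.
  intros Hf Hext A HA; unfold Theta_tilde.
  destruct excluded_middle_informative as [HS|HS]; [|rewrite Hext; auto; lra].
  apply Rnot_lt_le; intros Hlt.
  destruct (Hf A HA (PI / 2 + tr_atan n A - f A)) as [delta [Hd H]]; [lra|].
  destruct (Theta_hat_shift00 n (delta / 2) A HA HS) as [HS' Heq]; [lra|].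
  specialize (H (shift00 (delta / 2) A) (shift00_Sym n _ A HA)).
  rewrite mdist_shift00, Rabs_pos_eq, (Hext (shift00 _ A)), Heq in H
    by (lra || apply shift00_Sym, HA || exact HS').
  rewrite Carg_im_pos in H by (simpl; lra).
  simpl in H; rewrite Rdiv_0_l, atan_0 in H.
  specialize (H ltac:(lra)); lra.
Qed.

(** The mirror argument with t < 0, where the corner eigenvalue it has argument -PI/2. *)
Lemma Theta_tilde_low_greatest (n : nat) (f : Mat -> R) :
  lsc_on_Sym n f -> (forall A, Sym n A -> ~ in_S n A -> f A = Theta_hat n A) ->
  forall A, Sym n A -> f A <= Theta_tilde_low n A.
Proof.
  intros Hf Hext A HA; unfold Theta_tilde_low.
  destruct excluded_middle_informative as [HS|HS]; [|rewrite Hext; auto; lra].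
  apply Rnot_lt_le; intros Hlt.
  destruct (Hf A HA (f A - (- (PI / 2) + tr_atan n A))) as [delta [Hd H]]; [lra|].
  destruct (Theta_hat_shift00 n (- (delta / 2)) A HA HS) as [HS' Heq]; [lra|].
  specialize (H (shift00 (- (delta / 2)) A) (shift00_Sym n _ A HA)).
  rewrite mdist_shift00, Rabs_Ropp, Rabs_pos_eq, (Hext (shift00 _ A)), Heq in H
    by (lra || apply shift00_Sym, HA || exact HS').
  assert (HC : Carg (0, - (delta / 2)) = - (PI / 2)).
  { rewrite Carg_im_neg by (simpl; lra); simpl.
    rewrite Rdiv_0_l, atan_0; lra. }
  rewrite HC in H; specialize (H ltac:(lra)); lra.
Qed.

(** * Differentiability *)

Definition mnorm (n : nat) (H : Mat) : R := mdist n H mzero.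

(* [differentiable_at_Sym] with a bound on the differential, which makes the
   notion stable under composition without appealing to finite dimension. *)
Definition bdiff (n : nat) (f : Mat -> R) (A : Mat) : Prop :=
  exists L : Mat -> R,
    (forall H1 H2, Sym n H1 -> Sym n H2 -> L (madd H1 H2) = L H1 + L H2) /\
    (forall c H, Sym n H -> L (mscal c H) = c * L H) /\
    (exists K, 0 <= K /\ forall H, Sym n H -> Rabs (L H) <= K * mnorm n H) /\
    (forall eps, 0 < eps -> exists delta, 0 < delta /\
       forall H, Sym n H -> mnorm n H < delta ->
         Rabs (f (madd A H) - f A - L H) <= eps * mnorm n H).

Lemma mnorm_ge0 (n : nat) (H : Mat) : 0 <= mnorm n H.
Proof. apply sqrt_pos. Qed.

Lemma mdist_madd (n : nat) (A H : Mat) : mdist n A (madd A H) = mnorm n H.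
Proof.
  unfold mnorm, mdist; f_equal; apply sum_eq; intros i _; apply sum_eq; intros j _.
  unfold madd, mzero; ring.
Qed.

Lemma madd_Sym (n : nat) (A H : Mat) : Sym n A -> Sym n H -> Sym n (madd A H).
Proof. intros HA HH i j Hi Hj; unfold madd; now rewrite HA, HH. Qed.

Lemma bdiff_differentiable (n : nat) (f : Mat -> R) (A : Mat) :
  bdiff n f A -> differentiable_at_Sym n f A.
Proof. intros [L [H1 [H2 [_ H3]]]]; exists L; auto. Qed.

(** Tolerance 1 in the definition, added to the bound on the differential. In the chain rule this
    converts errors relative to the increment of [f] into errors relative to [mnorm]. *)
Lemma bdiff_lipschitz (n : nat) (f : Mat -> R) (A : Mat) :
  bdiff n f A -> exists K delta, 0 < K /\ 0 < delta /\
    forall H, Sym n H -> mnorm n H < delta ->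
      Rabs (f (madd A H) - f A) <= K * mnorm n H.
Proof.
  intros [L [_ [_ [[K [HK HL]] Hd]]]]; destruct (Hd 1 Rlt_0_1) as [delta [Hdel H]].
  exists (K + 1), delta; split; [lra|]; split; [exact Hdel|].
  intros X HX Hn; specialize (H X HX Hn); specialize (HL X HX).
  pose proof (Rabs_triang (f (madd A X) - f A - L X) (L X)) as Ht.
  replace (f (madd A X) - f A - L X + L X) with (f (madd A X) - f A) in Ht by ring; lra.
Qed.

Lemma bdiff_continuous (n : nat) (f : Mat -> R) (A : Mat) :
  bdiff n f A -> forall eps, 0 < eps -> exists delta, 0 < delta /\
    forall H, Sym n H -> mnorm n H < delta -> Rabs (f (madd A H) - f A) < eps.
Proof.
  intros Hf eps He; destruct (bdiff_lipschitz n f A Hf) as [K [d [HK [Hd H]]]].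
  exists (Rmin d (eps / K)); split.
  - apply Rmin_pos; [exact Hd | apply Rdiv_lt_0_compat; assumption].
  - intros X HX Hn; apply Rle_lt_trans with (K * mnorm n X).
    + apply H; [exact HX | apply Rlt_le_trans with (1 := Hn); apply Rmin_l].
    + replace eps with (K * (eps / K)) by (field; lra).
      apply Rmult_lt_compat_l; [exact HK | apply Rlt_le_trans with (1 := Hn); apply Rmin_r].
Qed.

Lemma bdiff_locally_eq (n : nat) (f g : Mat -> R) (A : Mat) :
  f A = g A ->
  (exists delta, 0 < delta /\ forall H, Sym n H -> mnorm n H < delta ->
     f (madd A H) = g (madd A H)) ->
  bdiff n g A -> bdiff n f A.
Proof.
  intros HA [d [Hd Heq]] [L [H1 [H2 [H3 H4]]]]; exists L; repeat split; auto.
  intros eps He; destruct (H4 eps He) as [d' [Hd' H]].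
  exists (Rmin d d'); split; [apply Rmin_pos; assumption|]; intros X HX Hn.
  pose proof (Rmin_l d d'); pose proof (Rmin_r d d').
  rewrite HA, Heq by (auto; lra); apply H; auto; lra.
Qed.

Lemma bdiff_const (n : nat) (c : R) (A : Mat) : bdiff n (fun _ => c) A.
Proof.
  exists (fun _ => 0); split; [intros; lra|]; split; [intros; lra|]; split.
  - exists 0; split; [lra|]; intros H _; rewrite Rabs_R0; lra.
  - intros eps He; exists 1; split; [lra|]; intros H _ _.
    rewrite !Rminus_0_r, Rminus_diag, Rabs_R0.
    apply Rmult_le_pos; [lra | apply mnorm_ge0].
Qed.

Lemma bdiff_entry (n : nat) (i j : nat) (A : Mat) :
  (i <= n)%nat -> (j <= n)%nat -> bdiff n (fun B => B i j) A.
Proof.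
  intros Hi Hj; exists (fun B => B i j); split; [reflexivity|]; split; [reflexivity|]; split.
  - exists 1; split; [lra|]; intros H _; rewrite Rmult_1_l, <- (Rminus_0_r (H i j)).
    exact (entry_le_mdist n H mzero i j Hi Hj).
  - intros eps He; exists 1; split; [lra|]; intros H _ _.
    unfold madd; replace (A i j + H i j - A i j - H i j) with 0 by ring.
    rewrite Rabs_R0; apply Rmult_le_pos; [lra | apply mnorm_ge0].
Qed.

Lemma bdiff_plus (n : nat) (f g : Mat -> R) (A : Mat) :
  bdiff n f A -> bdiff n g A -> bdiff n (fun B => f B + g B) A.
Proof.
  intros [L [H1 [H2 [[K [HK H3]] H4]]]] [L' [H1' [H2' [[K' [HK' H3']] H4']]]].
  exists (fun H => L H + L' H); split; [|split; [|split]].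
  - intros X Y HX HY; rewrite H1, H1' by auto; ring.
  - intros c X HX; rewrite H2, H2' by auto; ring.
  - exists (K + K'); split; [lra|]; intros X HX.
    pose proof (Rabs_triang (L X) (L' X)); specialize (H3 X HX); specialize (H3' X HX); lra.
  - intros eps He; destruct (H4 (eps / 2)) as [d [Hd H]]; [lra|].
    destruct (H4' (eps / 2)) as [d' [Hd' H']]; [lra|].
    exists (Rmin d d'); split; [apply Rmin_pos; assumption|]; intros X HX Hn.
    pose proof (Rmin_l d d'); pose proof (Rmin_r d d').
    specialize (H X HX ltac:(lra)); specialize (H' X HX ltac:(lra)).
    replace (f (madd A X) + g (madd A X) - (f A + g A) - (L X + L' X))
      with ((f (madd A X) - f A - L X) + (g (madd A X) - g A - L' X)) by ring.
    pose proof (Rabs_triang (f (madd A X) - f A - L X) (g (madd A X) - g A - L' X)); lra.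
Qed.

Lemma bdiff_comp (n : nat) (phi : R -> R) (d : R) (f : Mat -> R) (A : Mat) :
  derivable_pt_lim phi (f A) d -> bdiff n f A -> bdiff n (fun B => phi (f B)) A.
Proof.
  intros Hphi Hf; destruct (bdiff_lipschitz n f A Hf) as [C [dl [HC [Hdl Hlip]]]].
  pose proof (bdiff_continuous n f A Hf) as Hcont.
  destruct Hf as [L [H1 [H2 [[K [HK H3]] H4]]]].
  exists (fun H => d * L H); split; [|split; [|split]].
  - intros X Y HX HY; rewrite H1 by auto; ring.
  - intros c X HX; rewrite H2 by auto; ring.
  - exists (Rabs d * K); split; [apply Rmult_le_pos; [apply Rabs_pos | exact HK]|].
    intros X HX; rewrite Rabs_mult, Rmult_assoc.
    apply Rmult_le_compat_l; [apply Rabs_pos | auto].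
  - intros eps He.
    (* Half of [eps] goes to the remainder of [phi], scaled by the Lipschitz constant [C], and half
       to [d] times the remainder of [f]; [Rabs d + 1] avoids a zero denominator. *)
    assert (He1 : 0 < eps / (2 * C)) by (apply Rdiv_lt_0_compat; lra).
    pose proof (Rabs_pos d) as Hdp.
    assert (He2 : 0 < eps / (2 * (Rabs d + 1))) by (apply Rdiv_lt_0_compat; lra).
    destruct (Hphi _ He1) as [[h0 Hh0] Hh]; simpl in Hh.
    destruct (Hcont h0 Hh0) as [d1 [Hd1 Hc1]].
    destruct (H4 _ He2) as [d2 [Hd2 Hc2]].
    exists (Rmin dl (Rmin d1 d2)); split; [repeat apply Rmin_pos; assumption|].
    intros X HX Hn.
    pose proof (Rmin_l dl (Rmin d1 d2)); pose proof (Rmin_r dl (Rmin d1 d2)).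
    pose proof (Rmin_l d1 d2); pose proof (Rmin_r d1 d2).
    specialize (Hlip X HX ltac:(lra)); specialize (Hc1 X HX ltac:(lra)).
    specialize (Hc2 X HX ltac:(lra)).
    pose proof (mnorm_ge0 n X) as HN; set (N := mnorm n X) in *.
    set (h := f (madd A X) - f A) in *.
    replace (f (madd A X)) with (f A + h) by (unfold h; ring).
    assert (Hrem : Rabs (phi (f A + h) - phi (f A) - d * h) <= eps / (2 * C) * Rabs h).
    (* [derivable_pt_lim] speaks only of nonzero increments. *)
    { destruct (Req_dec h 0) as [Hz|Hz].
      - rewrite Hz, Rplus_0_r, Rmult_0_r, !Rminus_0_r, Rminus_diag, Rabs_R0; lra.
      - specialize (Hh h Hz Hc1).
        replace (phi (f A + h) - phi (f A) - d * h)
          with (((phi (f A + h) - phi (f A)) / h - d) * h) by (field; exact Hz).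
        rewrite Rabs_mult; apply Rmult_le_compat_r; [apply Rabs_pos | lra]. }
    replace (phi (f A + h) - phi (f A) - d * L X)
      with ((phi (f A + h) - phi (f A) - d * h) + d * (h - L X)) by ring.
    apply Rle_trans with (1 := Rabs_triang _ _).
    assert (E1 : eps / (2 * C) * Rabs h <= eps / 2 * N).
    { replace (eps / 2 * N) with (eps / (2 * C) * (C * N)) by (field; lra).
      apply Rmult_le_compat_l; lra. }
    assert (E2 : Rabs (d * (h - L X)) <= eps / 2 * N).
    { rewrite Rabs_mult.
      apply Rle_trans with ((Rabs d + 1) * (eps / (2 * (Rabs d + 1)) * N)).
      - apply Rmult_le_compat; try apply Rabs_pos; lra.
      - right; field; lra. }
    lra.
Qed.

Lemma bdiff_scal (n : nat) (c : R) (f : Mat -> R) (A : Mat) :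
  bdiff n f A -> bdiff n (fun B => c * f B) A.
Proof.
  intros Hf; apply (bdiff_comp n (fun x => c * x) (c * 1)); [|exact Hf].
  apply (derivable_pt_lim_scal (fun x => x)); apply derivable_pt_lim_id.
Qed.

Lemma bdiff_minus (n : nat) (f g : Mat -> R) (A : Mat) :
  bdiff n f A -> bdiff n g A -> bdiff n (fun B => f B - g B) A.
Proof.
  intros Hf Hg; apply (bdiff_locally_eq n _ (fun B => f B + (-1) * g B)); [ring| |].
  - exists 1; split; [lra|]; intros; ring.
  - apply bdiff_plus; [exact Hf | apply bdiff_scal; exact Hg].
Qed.

Lemma bdiff_sqr (n : nat) (f : Mat -> R) (A : Mat) :
  bdiff n f A -> bdiff n (fun B => Rsqr (f B)) A.
Proof. apply (bdiff_comp n Rsqr (2 * f A)); apply derivable_pt_lim_Rsqr. Qed.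

(* Polarisation: 4 f g = (f + g)^2 - (f - g)^2. *)
Lemma bdiff_mult (n : nat) (f g : Mat -> R) (A : Mat) :
  bdiff n f A -> bdiff n g A -> bdiff n (fun B => f B * g B) A.
Proof.
  intros Hf Hg.
  apply (bdiff_locally_eq n _ (fun B => / 4 * (Rsqr (f B + g B) - Rsqr (f B - g B)))).
  - unfold Rsqr; field.
  - exists 1; split; [lra|]; intros; unfold Rsqr; field.
  - apply bdiff_scal, bdiff_minus; apply bdiff_sqr;
      [apply bdiff_plus | apply bdiff_minus]; assumption.
Qed.

(** * Differentiability of the characteristic polynomial in the matrix *)

Definition Cbdiff (n : nat) (F : Mat -> C) (A : Mat) : Prop :=
  bdiff n (fun B => fst (F B)) A /\ bdiff n (fun B => snd (F B)) A.

Lemma Cbdiff_const (n : nat) (c : C) (A : Mat) : Cbdiff n (fun _ => c) A.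
Proof. split; apply bdiff_const. Qed.

Lemma Cbdiff_add (n : nat) (F G : Mat -> C) (A : Mat) :
  Cbdiff n F A -> Cbdiff n G A -> Cbdiff n (fun B => Cadd (F B) (G B)) A.
Proof. intros [? ?] [? ?]; split; apply bdiff_plus; assumption. Qed.

Lemma Cbdiff_mul (n : nat) (F G : Mat -> C) (A : Mat) :
  Cbdiff n F A -> Cbdiff n G A -> Cbdiff n (fun B => Cmul (F B) (G B)) A.
Proof.
  intros [? ?] [? ?]; split; [apply bdiff_minus | apply bdiff_plus];
    apply bdiff_mult; assumption.
Qed.

Lemma Cbdiff_opp (n : nat) (F : Mat -> C) (A : Mat) :
  Cbdiff n F A -> Cbdiff n (fun B => Copp (F B)) A.
Proof.
  intros [H1 H2]; split.
  - apply (bdiff_comp n Ropp (-1) (fun B => fst (F B))); [|exact H1].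
    apply (derivable_pt_lim_opp id _ 1); apply derivable_pt_lim_id.
  - apply (bdiff_comp n Ropp (-1) (fun B => snd (F B))); [|exact H2].
    apply (derivable_pt_lim_opp id _ 1); apply derivable_pt_lim_id.
Qed.

Lemma Cbdiff_Csum (n k : nat) (F : Mat -> nat -> C) (A : Mat) :
  (forall j, (j < k)%nat -> Cbdiff n (fun B => F B j) A) ->
  Cbdiff n (fun B => Csum k (F B)) A.
Proof.
  induction k as [|k IH]; intros H; simpl; [apply Cbdiff_const|].
  apply Cbdiff_add; [apply IH; intros j Hj; apply H; lia | apply H; lia].
Qed.

Lemma Cbdiff_det (n k : nat) (M : Mat -> CMat) (A : Mat) :
  (forall i j, (i < k)%nat -> (j < k)%nat -> Cbdiff n (fun B => M B i j) A) ->
  Cbdiff n (fun B => det k (M B)) A.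
Proof.
  revert M; induction k as [|k IH]; intros M H; [exact (Cbdiff_const n C1 A)|].
  apply (Cbdiff_Csum n (S k) (fun B j => Cmul (if Nat.even j then C1 else Copp C1)
    (Cmul (M B 0%nat j) (det k (minor j (M B)))))).
  intros j Hj; apply Cbdiff_mul; [apply Cbdiff_const|].
  apply Cbdiff_mul; [apply H; lia|].
  apply (IH (fun B => minor j (M B))); intros r c Hr Hc; unfold minor.
  destruct (Nat.ltb c j); apply H; lia.
Qed.

Lemma Cbdiff_charpoly_IiA (n : nat) (z : C) (A : Mat) :
  Cbdiff n (fun B => charpoly (S n) (IiA B) z) A.
Proof.
  unfold charpoly.
  apply (Cbdiff_det n (S n) (fun B i j =>
    if Nat.eqb i j then Csub z (IiA B i j) else Copp (IiA B i j))).
  intros i j Hi Hj.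
  assert (HI : Cbdiff n (fun B => IiA B i j) A).
  { split; simpl; [apply bdiff_const | apply bdiff_entry; lia]. }
  destruct (Nat.eqb i j); [apply Cbdiff_add; [apply Cbdiff_const|]|]; apply Cbdiff_opp, HI.
Qed.

(** * Polar form of the characteristic polynomial at 0 *)

Lemma Carg_polar (z : C) : 0 <= fst z -> z <> C0 ->
  exists r, 0 < r /\ z = (r * cos (Carg z), r * sin (Carg z)).
Proof.
  intros Hx Hz; destruct z as [x y]; destruct (Rle_lt_or_eq_dec _ _ Hx) as [Hx'|Hx'].
  - rewrite Carg_re_pos by exact Hx'; simpl in *.
    pose proof (atan_bound (y / x)) as Hb.
    assert (Hc : 0 < cos (atan (y / x))) by (apply cos_gt_0; lra).
    (* This is the modulus of (x, y), written so that the cosine cancels. *)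
    exists (x / cos (atan (y / x))); split; [apply Rdiv_lt_0_compat; assumption|].
    f_equal; [field; lra|].
    transitivity (x * tan (atan (y / x))); [rewrite tan_atan; field; lra|].
    unfold tan; field; lra.
  - unfold Carg; simpl in *; subst x.
    destruct (Rlt_dec 0 0); [lra|]; destruct (Rlt_dec 0 y) as [Hy|Hy].
    + exists y; split; [exact Hy|]; rewrite cos_PI2, sin_PI2; f_equal; ring.
    + destruct (Rlt_dec y 0) as [Hy'|Hy'].
      * exists (- y); split; [lra|].
        rewrite cos_neg, sin_neg, cos_PI2, sin_PI2; f_equal; ring.
      * exfalso; apply Hz; unfold C0; f_equal; lra.
Qed.

(** Moduli multiply and arguments add; stating the result through cos and sin makes reduction modulo
    2 PI unnecessary. Each factor 0 - lambda contributes a sign. *)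
Lemma prod_polar (l : list C) :
  (forall z, In z l -> 0 <= fst z /\ z <> C0) ->
  exists r, 0 < r /\ Cprod (map (fun lam => Csub C0 lam) l) =
    ((-1) ^ length l * r * cos (Rlsum (map Carg l)),
     (-1) ^ length l * r * sin (Rlsum (map Carg l))).
Proof.
  induction l as [|a l IH]; intros Hl.
  - exists 1; split; [lra|]; simpl; rewrite cos_0, sin_0; unfold C1; f_equal; ring.
  - destruct IH as [r [Hr IH]]; [intros z Hz; apply Hl; right; exact Hz|].
    destruct (Hl a (or_introl eq_refl)) as [Ha Ha0].
    destruct (Carg_polar a Ha Ha0) as [s [Hs Hpol]].
    exists (s * r); split; [apply Rmult_lt_0_compat; assumption|].
    cbn [map Cprod fold_right]; fold (Cprod (map (fun lam => Csub C0 lam) l)); rewrite IH.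
    change (Rlsum (Carg a :: map Carg l)) with (Carg a + Rlsum (map Carg l)).
    rewrite cos_plus, sin_plus.
    rewrite Hpol at 1; unfold Cmul, Csub, Cadd, Copp, C0; simpl; f_equal; ring.
Qed.

(** The value at 0 is (-1)^(n+1) det(I_n + iA), so [Theta_hat] is a branch of the argument of that
    determinant. *)
Lemma charpoly0_polar (n : nat) (A : Mat) :
  Sym n A -> charpoly (S n) (IiA A) C0 <> C0 ->
  exists r, 0 < r /\ charpoly (S n) (IiA A) C0 =
    ((-1) ^ S n * r * cos (Theta_hat n A), (-1) ^ S n * r * sin (Theta_hat n A)).
Proof.
  intros HA H0; pose proof (Spectra.spectrumP (S n) (IiA A)) as Hs.
  destruct (prod_polar (spectrum (S n) (IiA A))) as [r [Hr Hp]].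
  - intros z Hz; split; [exact (spectrum_re_ge0 n A z HA Hz)|].
    intros Hz0; subst; apply H0; exact (Spectra.in_spectrum_charpoly _ _ _ _ Hs Hz).
  - exists r; split; [exact Hr|]; destruct Hs as [Hlen Hs].
    rewrite Hs, Hp, Hlen; reflexivity.
Qed.

(** Off S the argument is continuous at every eigenvalue, so [spectral_sum_usc] applies to [Carg]
    and to its negative. *)
Lemma Theta_hat_continuous (n : nat) (A : Mat) : Sym n A -> ~ in_S n A ->
  forall eps, 0 < eps -> exists delta, 0 < delta /\
    forall B, Sym n B -> mdist n A B < delta ->
      Rabs (Theta_hat n B - Theta_hat n A) < eps.
Proof.
  intros HA HS eps He.
  assert (Hcv : forall a, is_eigenvalue n A a -> forall zs,
    (forall m, 0 <= fst (zs m)) -> Ccv zs a -> Un_cv (fun m => Carg (zs m)) (Carg a)).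
  { intros a Ha zs Hzs Hcv; apply Carg_cv; auto.
    - exact (Spectra.eigenvalue_re_ge0 n A a HA Ha).
    - intros H0; subst; exact (Spectra.eigenvalue_neq0 n A HA HS Ha). }
  destruct (spectral_sum_usc n Carg A) with (eps := eps) as [d1 [Hd1 H1]]; [|exact He|].
  { intros a Ha; apply cv_usc_at; auto. }
  destruct (spectral_sum_usc n (fun z => - Carg z) A) with (eps := eps)
    as [d2 [Hd2 H2]]; [|exact He|].
  { intros a Ha; apply cv_usc_at; intros zs Hzs Hz.
    apply (CV_opp (fun m => Carg (zs m))); auto. }
  exists (Rmin d1 d2); split; [apply Rmin_pos; assumption|]; intros B HB HAB.
  pose proof (Rmin_l d1 d2); pose proof (Rmin_r d1 d2).
  specialize (H1 B HB ltac:(lra)); specialize (H2 B HB ltac:(lra)).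
  rewrite !Rlsum_map_opp in H2; unfold Theta_hat; apply Rabs_def1; lra.
Qed.

(* With p = charpoly(0), the quotient p(B) / p(A) has argument Theta(B) - Theta(A) up
   to 2 pi, and continuity of Theta removes the ambiguity for B close to A. *)
Lemma Theta_hat_differentiable (n : nat) (A : Mat) :
  Sym n A -> ~ in_S n A -> differentiable_at_Sym n (Theta_hat n) A.
Proof.
  intros HA HS; apply bdiff_differentiable.
  set (p := fun B => charpoly (S n) (IiA B) C0).
  (* [X] and [Y] are the real and imaginary parts of p(B) times the conjugate of p(A), which has the
     same argument as p(B) / p(A). *)
  set (X := fun B => fst (p B) * fst (p A) + snd (p B) * snd (p A)).
  set (Y := fun B => snd (p B) * fst (p A) - fst (p B) * snd (p A)).
  assert (HpA : p A <> C0) by exact (Spectra.eigenvalue_neq0 n A HA HS).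
  destruct (Cbdiff_charpoly_IiA n C0 A) as [Hp1 Hp2].
  assert (HX : bdiff n X A).
  { apply bdiff_plus; apply bdiff_mult; solve [exact Hp1 | exact Hp2 | apply bdiff_const]. }
  assert (HY : bdiff n Y A).
  { apply bdiff_minus; apply bdiff_mult; solve [exact Hp1 | exact Hp2 | apply bdiff_const]. }
  assert (HXA : 0 < X A).
  { unfold X; destruct (Req_dec (fst (p A)) 0) as [E1|E1].
    - destruct (Req_dec (snd (p A)) 0) as [E2|E2].
      + exfalso; apply HpA; rewrite (surjective_pairing (p A)), E1, E2; reflexivity.
      + pose proof (Rsqr_pos_lt _ E2); pose proof (Rle_0_sqr (fst (p A))).
        unfold Rsqr in *; lra.
    - pose proof (Rsqr_pos_lt _ E1); pose proof (Rle_0_sqr (snd (p A))).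
      unfold Rsqr in *; lra. }
  destruct (charpoly0_polar n A HA HpA) as [rA [HrA HpolA]]; fold (p A) in HpolA.
  assert (Hsq : (-1) ^ S n * (-1) ^ S n = 1).
  { rewrite <- Rpow_mult_distr; replace (-1 * -1) with 1 by ring; apply pow1. }
  apply (bdiff_locally_eq n _ (fun B => Theta_hat n A + atan (Y B * (1 / X B)))).
  - replace (Y A) with 0 by (unfold Y; ring); rewrite Rmult_0_l, atan_0; ring.
  (* Tolerance [X A] keeps [X] positive near [A]; tolerance [PI / 2] for [Theta_hat] keeps its
     increment where [atan] inverts [tan]. *)
  - destruct (bdiff_continuous n X A HX (X A) HXA) as [d1 [Hd1 H1]].
    pose proof PI_RGT_0 as HPI.
    destruct (Theta_hat_continuous n A HA HS (PI / 2)) as [d2 [Hd2 H2]]; [lra|].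
    exists (Rmin d1 d2); split; [apply Rmin_pos; assumption|]; intros H HH Hn.
    pose proof (Rmin_l d1 d2); pose proof (Rmin_r d1 d2).
    specialize (H1 H HH ltac:(lra)).
    specialize (H2 (madd A H) (madd_Sym n A H HA HH)); rewrite mdist_madd in H2.
    specialize (H2 ltac:(lra)).
    pose proof (madd_Sym n A H HA HH) as HB; set (B := madd A H) in *; clearbody B.
    apply Rabs_def2 in H1; apply Rabs_def2 in H2.
    assert (HXB : 0 < X B) by lra.
    assert (HpB : p B <> C0).
    { intros E; unfold X in HXB; rewrite E in HXB; simpl in HXB; lra. }
    destruct (charpoly0_polar n B HB HpB) as [rB [HrB HpolB]]; fold (p B) in HpolB.
    set (sg := (-1) ^ S n) in *; set (th := Theta_hat n B - Theta_hat n A) in *.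
    assert (HXB' : X B = rA * rB * cos th).
    { unfold X, th; rewrite HpolA, HpolB, cos_minus; simpl.
      transitivity (sg * sg * (rA * rB * (cos (Theta_hat n B) * cos (Theta_hat n A)
        + sin (Theta_hat n B) * sin (Theta_hat n A)))); [ring | rewrite Hsq; ring]. }
    assert (HYB' : Y B = rA * rB * sin th).
    { unfold Y, th; rewrite HpolA, HpolB, sin_minus; simpl.
      transitivity (sg * sg * (rA * rB * (sin (Theta_hat n B) * cos (Theta_hat n A)
        - cos (Theta_hat n B) * sin (Theta_hat n A)))); [ring | rewrite Hsq; ring]. }
    assert (Hcos : 0 < cos th) by (apply cos_gt_0; lra).
    replace (Y B * (1 / X B)) with (tan th).
    + rewrite atan_tan by lra; unfold th; ring.
    + rewrite HXB', HYB'; unfold tan; field; lra.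
  - apply bdiff_plus; [apply bdiff_const|].
    apply (bdiff_comp n atan (/ (1 + (Y A * (1 / X A)) ^ 2)) (fun B => Y B * (1 / X B))).
    + apply derivable_pt_lim_atan.
    + apply bdiff_mult; [exact HY|].
      refine (bdiff_comp n (fct_cte 1 / id)%F _ X A
        (derivable_pt_lim_div _ _ _ _ _ (derivable_pt_lim_const 1 _)
          (derivable_pt_lim_id _) _) HX).
      unfold id; lra.
Qed.

Theorem theorem3p1 (n : nat) (hn : (1 <= n)%nat) :
  (forall A, Sym n A -> ~ in_S n A ->
     forall z, is_eigenvalue n A z -> z <> C0 /\ 0 <= fst z)
  /\ (forall A, Sym n A -> ~ in_S n A -> differentiable_at_Sym n (Theta_hat n) A)
  /\ (usc_on_Sym n (Theta_tilde n)
      /\ (forall A, Sym n A -> ~ in_S n A -> Theta_tilde n A = Theta_hat n A)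
      /\ (forall f : Mat -> R, usc_on_Sym n f ->
            (forall A, Sym n A -> ~ in_S n A -> f A = Theta_hat n A) ->
            forall A, Sym n A -> Theta_tilde n A <= f A))
  /\ (lsc_on_Sym n (Theta_tilde_low n)
      /\ (forall A, Sym n A -> ~ in_S n A -> Theta_tilde_low n A = Theta_hat n A)
      /\ (forall f : Mat -> R, lsc_on_Sym n f ->
            (forall A, Sym n A -> ~ in_S n A -> f A = Theta_hat n A) ->
            forall A, Sym n A -> f A <= Theta_tilde_low n A)).
Proof.
  split; [|split; [exact (Theta_hat_differentiable n)|split; split]].
  - intros A HA HS z Hz; split; [|exact (Spectra.eigenvalue_re_ge0 n A z HA Hz)].
    intros H0; subst; exact (Spectra.eigenvalue_neq0 n A HA HS Hz).
  - apply usc_Theta_tilde.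
  - split; [|apply Theta_tilde_least].
    intros A _ HS; unfold Theta_tilde.
    destruct excluded_middle_informative; [contradiction | reflexivity].
  - apply lsc_Theta_tilde_low.
  - split; [|apply Theta_tilde_low_greatest].
    intros A _ HS; unfold Theta_tilde_low.
    destruct excluded_middle_informative; [contradiction | reflexivity].
Qed.
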